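(* Let $(X,0)\subset(k^n,0)$ be a hypersurface germ. (0) Every torsion-free module over $(X,0)$ is $X/X$-saturated (i.e. saturated with respect to the identity modification). (1) For any torsion-free module $E$ on $(X,0)$ there exists the unique maximal finite modification $(X',0)\to(X,0)$ such that $E$ is $X'/X$-saturated. Namely, if $E$ is also $X''/X$-saturated for a finite modification $(X'',0)\to(X,0)$, then the modification $(X',0)\to(X,0)$ factorizes as $(X',0)\to(X'',0)\to(X,0)$. (2) Let $(X',0)\to(X,0)$ be a finite modification and let $E$ be the kernel module of a determinantal representation $\mathcal{M}$ of $(X,0)$. Then the module $E$ is $X'/X$-saturated if and only if the determinantal representation $\mathcal{M}$ is $X'/X$-saturated. (3) With $\mathcal{M}$, $E$ and $(X',0)\to(X,0)$ as in (2), and $tr(E)$ the kernel module of $\mathcal{M}^T$: $E$ is $X'/X$-saturated if and only if $tr(E)$ is $X'/X$-saturated.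
   Context: $k$ is an algebraically closed, normed, complete field of characteristic zero; $\mathcal{O}=\mathcal{O}_{(k^n,0)}$ is either $k\{x_1,\dots,x_n\}$ (locally convergent power series) or $k[[x_1,\dots,x_n]]$. Hypersurface germs $(X,0)=\{f=0\}$ are taken with multiplicities (possibly reducible, non-reduced), $\mathcal{O}_{(X,0)}=\mathcal{O}/(f)$. A finite modification $\nu:(X',0)\to(X,0)$ is a proper, surjective, finite, birational morphism of pure-dimensional schemes which is an isomorphism outside the singular locus of $(X,0)$; $(X',0)$ may be a multi-germ. Finite modifications lie between $(X,0)$ and its normalization $(\tilde X,0)$, i.e. correspond to intermediate rings $\mathcal{O}_{(X,0)}\subset\mathcal{O}_{(X',0)}\subset\mathcal{O}_{(\tilde X,0)}$. (If $X=\bigcup p_iX_i$ with $X_i$ reduced irreducible, the normalization is $\coprod p_i\tilde X_i$.) For a torsion-free $\mathcal{O}_{(X,0)}$-module $E$, $\nu^*E/\mathrm{Torsion}=(E\otimes_{\mathcal{O}_{(X,0)}}\mathcal{O}_{(X',0)})/\mathrm{Torsion}$ is the torsion-free pullback; $E$ embeds naturally into $\nu_*(\nu^*E/\mathrm{Torsion})$. The module $E$ is called $X'/X$-saturated if this embedding is an isomorphism. A determinantal representation of $(X,0)$ is a $d\times d$ matrix $\mathcal{M}$ over $\mathcal{O}$, $d>1$, vanishing at the origin, with $\det\mathcal{M}=f$ up to a unit; $\mathcal{M}^\vee$ is its adjoint (adjugate) matrix. Its kernel module $E$ is the $\mathcal{O}_{(X,0)}$-submodule of $\mathcal{O}_{(X,0)}^{\oplus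 d}$ generated by the columns of $\mathcal{M}^\vee$. The relative adjoint ideal is $Adj_{X'/X}=\{g\in\mathcal{O}:\ g\,\nu_*\mathcal{O}_{(X',0)}\subset\mathcal{O}_{(X,0)}\}$. The determinantal representation $\mathcal{M}$ is called $X'/X$-saturated if every entry of $\mathcal{M}^\vee$ belongs to $Adj_{X'/X}$. *)

(* Defs.v *)
From HB Require Import structures.
From mathcomp Require Import all_boot all_order all_algebra.
From mathcomp Require Import boolp reals.
From mathcomp Require Import freeg mpoly.

Set Implicit Arguments.
Unset Strict Implicit.
Unset Printing Implicit Defensive.

Import Order.TTheory GRing.Theory Num.Theory.
Import Quotient.Exports.

Local Open Scope ring_scope.
Local Open Scope quotient_scope.

Section FormalPowerSeries.
Variables (n : nat) (K : comNzRingType).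

Record fps := FPS { fcoef : 'X_{1..n} -> K }.

HB.instance Definition _ := gen_eqMixin fps.
HB.instance Definition _ := gen_choiceMixin fps.

Implicit Types f g h : fps.

Lemma fpsP f g : (forall m, fcoef f m = fcoef g m) -> f = g.
Proof. by case: f => f; case: g => g /= fg; congr FPS; apply/funext. Qed.

Definition fps0 := FPS (fun=> 0).
Definition fps1 := FPS (fun m => (m == 0%MM)%:R).
Definition fpsN f := FPS (fun m => - fcoef f m).
Definition fpsD f g := FPS (fun m => fcoef f m + fcoef g m).
Definition fpsM f g := FPS (fun m =>
  \sum_(h : 'X_{1..n < (mdeg m).+1, (mdeg m).+1} | m == (h.1 + h.2)%MM)
     fcoef f h.1 * fcoef g h.2).

Fact fpsDA : associative fpsD.
Proof. by move=> f g h; apply: fpsP => m /=; rewrite addrA. Qed.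
Fact fpsDC : commutative fpsD.
Proof. by move=> f g; apply: fpsP => m /=; rewrite addrC. Qed.
Fact fps0D : left_id fps0 fpsD.
Proof. by move=> f; apply: fpsP => m /=; rewrite add0r. Qed.
Fact fpsND : left_inverse fps0 fpsN fpsD.
Proof. by move=> f; apply: fpsP => m /=; rewrite addNr. Qed.

HB.instance Definition _ := GRing.isZmodule.Build fps fpsDA fpsDC fps0D fpsND.

Definition ftrunc N f : {mpoly K[n]} :=
  \sum_(m : 'X_{1..n < N}) fcoef f m *: 'X_[m].

Lemma mcoeff_ftrunc N f m : (mdeg m < N)%N -> (ftrunc N f)@_m = fcoef f m.
Proof.
move=> mN; rewrite raddf_sum /= (bigD1 (BMultinom mN)) //= big1 ?addr0.
  by rewrite mcoeffZ mcoeffX eqxx mulr1.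
move=> i; rewrite -val_eqE /= => /negPf neq.
by rewrite mcoeffZ mcoeffX neq mulr0.
Qed.

Lemma mcoeff_ftruncM N f g m : (mdeg m < N)%N ->
  (ftrunc N f * ftrunc N g)@_m = fcoef (fpsM f g) m.
Proof.
move=> mN; rewrite mcoeffM /=; apply: eq_bigr => -[h1 h2] /= _.
by rewrite !mcoeff_ftrunc // (leq_trans _ mN) // bmdeg.
Qed.

Lemma mcoeffM_eq (p p' q q' : {mpoly K[n]}) N :
    (forall m, (mdeg m < N)%N -> p@_m = p'@_m) ->
    (forall m, (mdeg m < N)%N -> q@_m = q'@_m) ->
  forall m, (mdeg m < N)%N -> (p * q)@_m = (p' * q')@_m.
Proof.
move=> pp qq m mN; rewrite !mcoeffM; apply: eq_bigr => -[h1 h2] /= _.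
by rewrite pp ?qq // (leq_trans _ mN) // bmdeg.
Qed.

Fact fpsMA : associative fpsM.
Proof.
move=> f g h; apply: fpsP => m; have mN := ltnSn (mdeg m).
rewrite -!(mcoeff_ftruncM _ _ mN).
have trM a b m' : (mdeg m' < (mdeg m).+1)%N ->
    (ftrunc (mdeg m).+1 (fpsM a b))@_m' =
    (ftrunc (mdeg m).+1 a * ftrunc (mdeg m).+1 b)@_m'.
  by move=> lt; rewrite mcoeff_ftrunc // mcoeff_ftruncM.
rewrite (mcoeffM_eq (fun _ _ => erefl) (trM g h) mN) mulrA.
by rewrite (mcoeffM_eq (trM f g) (fun _ _ => erefl) mN).
Qed.

Fact fpsMC : commutative fpsM.
Proof.
move=> f g; apply: fpsP => m; have mN := ltnSn (mdeg m).
by rewrite -!(mcoeff_ftruncM _ _ mN) mulrC.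
Qed.

Fact fps1M : left_id fps1 fpsM.
Proof.
move=> f; apply: fpsP => m; have mN := ltnSn (mdeg m).
rewrite -(mcoeff_ftruncM _ _ mN) -(mcoeff_ftrunc f mN) -[in RHS](mul1r (ftrunc _ f)).
apply: (mcoeffM_eq _ (fun _ _ => erefl) mN) => m' mN'.
by rewrite mcoeff_ftrunc // mcoeff1.
Qed.

Fact fpsMDl : left_distributive fpsM fpsD.
Proof.
move=> f g h; apply: fpsP => m /=; rewrite -big_split /=.
by apply: eq_bigr => i _; rewrite mulrDl.
Qed.

Fact fps1_neq0 : fps1 != 0.
Proof.
apply/eqP => /(congr1 (fun f => fcoef f 0%MM)) /= /eqP.
by rewrite eqxx oner_eq0.
Qed.

HB.instance Definition _ := GRing.Zmodule_isComNzRing.Build fps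
  fpsMA fpsMC fps1M fpsMDl fps1_neq0.

Lemma fcoefB f g m : fcoef (f - g) m = fcoef f m - fcoef g m.
Proof. by []. Qed.

Definition fps_deriv (i : 'I_n) f : fps :=
  FPS (fun m => fcoef f (m + U_(i))%MM *+ (m i).+1).

End FormalPowerSeries.

Record absvalue (k : fieldType) (R : realType) := AbsValue {
  absv :> k -> R;
  absv_ge0 : forall x, 0 <= absv x;
  absv_eq0 : forall x, (absv x == 0) = (x == 0);
  absvM : forall x y, absv (x * y) = absv x * absv y;
  absv_triangle : forall x y, absv (x + y) <= absv x + absv y }.

Definition complete_absvalue (k : fieldType) (R : realType)
    (v : absvalue k R) : Prop :=
  forall u : nat -> k,
    (forall e : R, 0 < e ->
      exists N, forall i j, (N <= i)%N -> (N <= j)%N -> v (u i - u j) < e) ->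
  exists l : k, forall e : R, 0 < e ->
      exists N, forall i, (N <= i)%N -> v (u i - l) < e.

Section AbsValueTheory.
Variables (k : fieldType) (R : realType) (v : absvalue k R).

Lemma absv0 : v 0 = 0. Proof. by apply/eqP; rewrite absv_eq0. Qed.

Lemma absv1 : v 1 = 1.
Proof.
have v1 : v 1 != 0 by rewrite absv_eq0 oner_eq0.
by apply: (mulfI v1); rewrite -absvM !mulr1.
Qed.

Lemma absvN x : v (- x) = v x.
Proof.
have/eqP := absvM v (-1) (-1); rewrite mulrNN mulr1 absv1 eq_sym -expr2.
rewrite sqrf_eq1 => /orP[] /eqP vN1; first by rewrite -mulN1r absvM vN1 mul1r.
by have := absv_ge0 v (-1); rewrite vN1 oppr_ge0 ler10.
Qed.

Lemma absv_sum I (r : seq I) (P : pred I) (F : I -> k) :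
  v (\sum_(i <- r | P i) F i) <= \sum_(i <- r | P i) v (F i).
Proof.
elim/big_rec2: _ => [|i y x _ le]; first by rewrite absv0.
by apply: le_trans (absv_triangle _ _ _) _; rewrite lerD2l.
Qed.

Lemma absvMn x m : v (x *+ m) <= v x *+ m.
Proof.
elim: m => [|m IH]; first by rewrite !mulr0n absv0.
by rewrite !mulrS; apply: le_trans (absv_triangle _ _ _) _; rewrite lerD2l.
Qed.

Variable n : nat.
Implicit Types f g : fps n k.

Definition fps_norm (r : R) N f : R :=
  \sum_(m : 'X_{1..n < N}) v (fcoef f m) * r ^+ mdeg m.

(* Absolute convergence on some polydisc about the origin. *)
Definition convergent f : Prop :=
  exists r : R, 0 < r /\ exists C : R, forall N, fps_norm r N f <= C.

Lemma fps_norm_ge0 r N f : 0 <= r -> 0 <= fps_norm r N f.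
Proof.
by move=> r0; apply: sumr_ge0 => m _; rewrite mulr_ge0 ?absv_ge0 ?exprn_ge0.
Qed.

Lemma fps_norm_le r s N f : 0 <= r -> r <= s -> fps_norm r N f <= fps_norm s N f.
Proof.
move=> r0 rs; apply: ler_sum => m _; rewrite ler_wpM2l ?absv_ge0 //.
by rewrite lerXn2r ?nnegrE // (le_trans r0).
Qed.

Lemma convergent2 f g : convergent f -> convergent g ->
  exists r : R, 0 < r /\ exists C : R, 0 <= C /\
    forall N, fps_norm r N f <= C /\ fps_norm r N g <= C.
Proof.
move=> [r [r0 [C hC]]] [s [s0 [D hD]]].
have m0 : 0 < Num.min r s by rewrite lt_min r0.
exists (Num.min r s); split => //; exists (Num.max C D); split.
  by rewrite le_max (le_trans (fps_norm_ge0 0 f (ltW r0)) (hC 0%N)).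
move=> N; rewrite !le_max.
rewrite (le_trans (fps_norm_le N f (ltW m0) _) (hC N)) ?ge_min ?lexx //.
by rewrite (le_trans (fps_norm_le N g (ltW m0) _) (hD N)) ?ge_min ?lexx ?orbT.
Qed.

Lemma convergent1 : convergent 1.
Proof.
exists 1; split => //; exists 1 => -[|N].
  by rewrite /fps_norm big1 // => -[].
have d0 : (mdeg (0%MM : 'X_{1..n}) < N.+1)%N by rewrite mdeg0.
rewrite /fps_norm (bigD1 (BMultinom d0)) //= big1.
  by rewrite eqxx absv1 expr1n mulr1 addr0.
by move=> m; rewrite -val_eqE /= => /negPf ->; rewrite absv0 mul0r.
Qed.

Lemma convergentB f g : convergent f -> convergent g -> convergent (f - g).
Proof.
move=> cf cg; have [r [r0 [C [_ hC]]]] := convergent2 cf cg.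
exists r; split => //; exists (C + C) => N; have [hf hg] := hC N.
apply: le_trans (lerD hf hg); rewrite /fps_norm -big_split /=.
apply: ler_sum => m _; rewrite -mulrDl ler_wpM2r ?exprn_ge0 ?(ltW r0) //.
by apply: le_trans (absv_triangle _ _ _) _; rewrite absvN.
Qed.

Lemma fps_normM r N f g : 0 <= r ->
  fps_norm r N (f * g) <= fps_norm r N f * fps_norm r N g.
Proof.
move=> r0; pose F m := v (fcoef f m) * r ^+ mdeg m.
pose G m := v (fcoef g m) * r ^+ mdeg m.
have F0 m : 0 <= F m by rewrite mulr_ge0 ?absv_ge0 ?exprn_ge0.
have G0 m : 0 <= G m by rewrite mulr_ge0 ?absv_ge0 ?exprn_ge0.
have coefM (m : 'X_{1..n < N}) : fcoef (f * g) m =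
    \sum_(h1 : 'X_{1..n < N}) \sum_(h2 : 'X_{1..n < N} | bmnm m == (h1 + h2)%MM)
      fcoef f h1 * fcoef g h2.
  rewrite -(mcoeff_ftruncM f g (bmdeg m)) /ftrunc mulr_suml raddf_sum /=.
  apply: eq_bigr => h1 _; rewrite mulr_sumr raddf_sum /= [RHS]big_mkcond /=.
  apply: eq_bigr => h2 _.
  rewrite -scalerAl -scalerAr scalerA -mpolyXD mcoeffZ mcoeffX eq_sym.
  by case: eqP => _; rewrite ?mulr1 ?mulr0.
rewrite {1}/fps_norm.
apply: (@le_trans _ _ (\sum_(m : 'X_{1..n < N}) \sum_(h1 : 'X_{1..n < N})
   \sum_(h2 : 'X_{1..n < N} | bmnm m == (h1 + h2)%MM) F h1 * G h2)).
  apply: ler_sum => m _; rewrite coefM.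
  apply: (@le_trans _ _ ((\sum_(h1 : 'X_{1..n < N})
      \sum_(h2 : 'X_{1..n < N} | bmnm m == (h1 + h2)%MM)
      v (fcoef f h1) * v (fcoef g h2)) * r ^+ mdeg m)).
    rewrite ler_wpM2r ?exprn_ge0 //; apply: le_trans (absv_sum _ _ _) _.
    apply: ler_sum => h1 _; apply: le_trans (absv_sum _ _ _) _.
    by apply: ler_sum => h2 _; rewrite absvM.
  rewrite mulr_suml; apply: ler_sum => h1 _; rewrite mulr_suml.
  apply: ler_sum => h2 /eqP ->; rewrite mdegD exprD /F /G.
  by rewrite mulrACA.
rewrite exchange_big /= /fps_norm mulr_suml; apply: ler_sum => h1 _.
rewrite mulr_sumr (exchange_big_dep predT) //=; apply: ler_sum => h2 _.
rewrite sumr_const -[leRHS]mulr1n; apply: ler_wpMn2l; first exact: mulr_ge0.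
apply/card_le1_eqP => x y hx hy.
have/eqP ex : bmnm x == (h1 + h2)%MM by exact: hx.
have/eqP ey : bmnm y == (h1 + h2)%MM by exact: hy.
by apply/eqP; rewrite bmeqP ex ey.
Qed.

Lemma convergentM f g : convergent f -> convergent g -> convergent (f * g).
Proof.
move=> cf cg; have [r [r0 [C [C0 hC]]]] := convergent2 cf cg.
exists r; split => //; exists (C * C) => N; have [hf hg] := hC N.
apply: le_trans (fps_normM _ _ _ (ltW r0)) _.
by apply: ler_pM => //; apply: fps_norm_ge0; apply: ltW.
Qed.

Lemma convergent_deriv i f : convergent f -> convergent (fps_deriv i f).
Proof.
move=> [r [r0 [C hC]]]; have s0 : 0 < r / 2 by rewrite divr_gt0.
exists (r / 2); split => //; exists (C * (r / 2)^-1) => N.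
rewrite ler_pdivlMr //; apply: le_trans (hC N.+1).
have le1 (m : 'X_{1..n}) : ((m i).+1)%:R * (2^-1 : R) ^+ (mdeg m).+1 <= 1.
  rewrite exprVn ler_pdivrMr ?exprn_gt0 // mul1r -natrX ler_nat.
  rewrite (leq_trans _ (ltnW (ltn_expl _ _))) // ltnS mdegE.
  by rewrite (bigD1 i) //= leq_addr.
rewrite /fps_norm mulr_suml.
apply: (@le_trans _ _ (\sum_(m : 'X_{1..n < N})
    v (fcoef f (m + U_(i))%MM) * r ^+ mdeg (m + U_(i))%MM)).
  apply: ler_sum => m _ /=; rewrite mdegD mdeg1 addn1 -mulrA -exprSr.
  have p0 : 0 <= (r / 2) ^+ (mdeg m).+1 by rewrite exprn_ge0 // ltW.
  apply: le_trans (ler_wpM2r p0 (absvMn _ _)) _.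
  rewrite -[v _ *+ _]mulr_natr exprMn -mulrA ler_wpM2l ?absv_ge0 //.
  by rewrite mulrCA ler_piMr ?exprn_ge0 ?(ltW r0) // le1.
have ltS (m : 'X_{1..n < N}) : (mdeg (m + U_(i))%MM < N.+1)%N.
  by rewrite mdegD mdeg1 addn1 ltnS bmdeg.
pose sh m := BMultinom (ltS m).
have shI : injective sh.
  move=> m m' /(congr1 (@bmnm _ _)) /= /eqP.
  by rewrite eqm_add2r => /eqP ?; apply: val_inj.
rewrite -[leLHS]/(\sum_(m : 'X_{1..n < N})
   (fun m : 'X_{1..n < N.+1} => v (fcoef f m) * r ^+ mdeg m) (sh m)).
rewrite -(big_imset _ (in2W shI)) /=.
rewrite [leRHS](bigID (mem [set sh x | x in [set: 'X_{1..n < N}]])) /=.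
rewrite (eq_bigl (mem [set sh x | x in [set: 'X_{1..n < N}]])); last first.
  by move=> x; apply/imsetP/imsetP => -[y _ ->]; exists y; rewrite ?inE.
rewrite lerDl; apply: sumr_ge0 => m _.
by rewrite mulr_ge0 ?absv_ge0 ?exprn_ge0 // ltW.
Qed.

End AbsValueTheory.

Variant flavour := Formal | Convergent.

Section LocalRing.
Variables (k : fieldType) (R : realType) (v : absvalue k R).
Variables (c : flavour) (n : nat).

Definition admissible : {pred fps n k} :=
  fun f => if c is Convergent then `[< convergent v f >] else true.

Fact admissible_subring : subring_closed admissible.
Proof.
rewrite /admissible; case: c => //; split => [|f g|f g].
- by apply/asboolP/convergent1.
- by move=> /asboolP cf /asboolP cg; apply/asboolP/convergentB.
- by move=> /asboolP cf /asboolP cg; apply/asboolP/convergentM.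
Qed.

HB.instance Definition _ :=
  GRing.isSubringClosed.Build (fps n k) admissible admissible_subring.

(* k[[x_1, ..., x_n]] or k{x_1, ..., x_n}, according to c. *)
Record germ := Germ { germ_fps :> fps n k; germP : germ_fps \in admissible }.

HB.instance Definition _ := [isSub for germ_fps].
HB.instance Definition _ := [Choice of germ by <:].
HB.instance Definition _ := [SubChoice_isSubComNzRing of germ by <:].

Definition germ_at0 (f : germ) : k := fcoef f 0%MM.

Fact germ_deriv_subproof i (f : germ) : fps_deriv i f \in admissible.
Proof.
rewrite unfold_in /admissible; have := germP f.
rewrite unfold_in /admissible; case: c => // /asboolP cf.
by apply/asboolP/convergent_deriv.
Qed.

Definition germ_deriv i (f : germ) : germ := Germ (germ_deriv_subproof i f).

Record hypersurface := Hypersurface {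
  hs_eqn : germ;
  hs_eqn_neq0 : hs_eqn != 0;
  hs_eqn_at0 : germ_at0 hs_eqn = 0 }.

Definition hs_ideal (X : hypersurface) : {pred germ} :=
  fun g => `[< exists h, g = h * hs_eqn X >].

Lemma germ_at0M (f g : germ) : germ_at0 (f * g) = germ_at0 f * germ_at0 g.
Proof.
have m0 : (mdeg (0%MM : 'X_{1..n}) < 1)%N by rewrite mdeg0.
rewrite /germ_at0 -[LHS]/(fcoef (fpsM (germ_fps f) (germ_fps g)) 0%MM).
rewrite -(mcoeff_ftruncM (germ_fps f) (germ_fps g) m0).
by rewrite (mcoeff0_is_multiplicative _ _).1 !mcoeff_ftrunc.
Qed.

Fact hs_ideal_closed X : idealr_closed (hs_ideal X).
Proof.
split.
- by apply/asboolP; exists 0; rewrite mul0r.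
- apply/negP => /asboolP[h /(congr1 germ_at0)]; rewrite germ_at0M hs_eqn_at0.
  by rewrite mulr0 /germ_at0 /= eqxx => /eqP; rewrite oner_eq0.
- move=> a _ _ /asboolP[g ->] /asboolP[h ->]; apply/asboolP.
  by exists (a * g + h); rewrite mulrDl mulrA.
Qed.

HB.instance Definition _ X := isIdealr.Build germ (hs_ideal X) (hs_ideal_closed X).

Definition hs_ring X := {ideal_quot (hs_ideal X)}.

HB.instance Definition _ X := GRing.ComNzRing.on (hs_ring X).

Definition hs_proj X : germ -> hs_ring X := \pi_({ideal_quot (hs_ideal X)}).

HB.instance Definition _ X := GRing.RMorphism.on (@hs_proj X).

End LocalRing.

Section QuotientModule.
Variables (A : comNzRingType) (V : lmodType A) (S : submodClosed V).

Definition modulus : {pred V} := S.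

Fact modulus_zmod_closed : zmod_closed modulus.
Proof. exact: GRing.submod_closedB (submodClosedP S). Qed.

HB.instance Definition _ := GRing.isZmodClosed.Build V modulus modulus_zmod_closed.

Definition modquot := Quotient.quot modulus.

HB.instance Definition _ := GRing.Zmodule.on modquot.

Definition modproj : V -> modquot := \pi_(Quotient.quot modulus).

HB.instance Definition _ := GRing.Additive.on modproj.

Lemma modproj_eq x y : (modproj x == modproj y) = (x - y \in S).
Proof. by rewrite /modproj -Quotient.idealrBE. Qed.

Lemma modproj_repr (x : modquot) : modproj (repr (x : Quotient.quot modulus)) = x.
Proof. exact: reprK. Qed.

Definition modquot_scale a (x : modquot) : modquot :=
  modproj (a *: repr (x : Quotient.quot modulus)).

Fact modproj_scale a x : modproj (a *: x) = modquot_scale a (modproj x).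
Proof.
apply/eqP; rewrite modproj_eq -scalerBr rpredZ // -modproj_eq.
by rewrite modproj_repr.
Qed.

Fact modquot_scaleA a b x :
  modquot_scale a (modquot_scale b x) = modquot_scale (a * b) x.
Proof. by rewrite -(modproj_repr x) -!modproj_scale scalerA. Qed.
Fact modquot_scale1 : left_id 1 modquot_scale.
Proof. by move=> x; rewrite -(modproj_repr x) -modproj_scale scale1r. Qed.
Fact modquot_scaleDr : right_distributive modquot_scale +%R.
Proof.
move=> a x y; rewrite -(modproj_repr x) -(modproj_repr y) -raddfD.
by rewrite -!modproj_scale scalerDr raddfD.
Qed.
Fact modquot_scaleDl x : {morph modquot_scale^~ x : a b / a + b}.
Proof.
by move=> a b; rewrite -(modproj_repr x) -!modproj_scale scalerDl raddfD.
Qed.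

HB.instance Definition _ := GRing.Zmodule_isLmodule.Build A modquot
  modquot_scaleA modquot_scale1 modquot_scaleDr modquot_scaleDl.
HB.instance Definition _ :=
  GRing.isScalable.Build A V modquot *:%R modproj modproj_scale.

End QuotientModule.

Section Torsion.
Variables (A : comNzRingType) (V : lmodType A).

Definition torsion : {pred V} :=
  fun x => `[< exists a : A, GRing.lreg a /\ a *: x = 0 >].

Fact torsion_closed : submod_closed torsion.
Proof.
split; first by apply/asboolP; exists 1; split; [exact: lreg1 | rewrite scaler0].
move=> a x y /asboolP[b [rb bx]] /asboolP[c [rc cy]]; apply/asboolP.
exists (b * c); split; first exact: lregM.
have -> : (b * c) *: (a *: x + y) = (c * a) *: (b *: x) + b *: (c *: y).
  by rewrite scalerDr !scalerA -mulrA (mulrC b).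
by rewrite bx cy !scaler0 addr0.
Qed.

HB.instance Definition _ := GRing.isSubmodClosed.Build A V torsion torsion_closed.

Definition torsion_free : Prop := forall x : V, x \in torsion -> x = 0.

End Torsion.

Section TorsionFreePullback.
Variables (A B : comNzRingType) (nu : {rmorphism A -> B}) (E : lmodType A).

(* In the free B-module on E, << b *g e >> stands for the tensor e (x) b. *)
Inductive tensor_relation : {freeg E / B} -> Prop :=
| TensorAdd e1 e2 : tensor_relation (<< e1 + e2 >> - << e1 >> - << e2 >>)
| TensorScale a e : tensor_relation (<< a *: e >> - << nu a *g e >>)
| TensorZero : tensor_relation 0
| TensorLin b x y :
    tensor_relation x -> tensor_relation y -> tensor_relation (b *: x + y).

Definition tensor_relations : {pred {freeg E / B}} :=
  fun x => `[< tensor_relation x >].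

Fact tensor_relations_closed : submod_closed tensor_relations.
Proof.
split; first by apply/asboolP; apply: TensorZero.
by move=> b x y /asboolP hx /asboolP hy; apply/asboolP; apply: TensorLin.
Qed.

HB.instance Definition _ := GRing.isSubmodClosed.Build B {freeg E / B}
  tensor_relations tensor_relations_closed.

Definition base_change : lmodType B := modquot tensor_relations.

Definition pullback_mod_torsion : lmodType B := modquot (@torsion B base_change).

Definition pullback_unit (e : E) : pullback_mod_torsion :=
  modproj (@torsion B base_change) (modproj tensor_relations << e >>).

Definition saturated : Prop := bijective pullback_unit.

End TorsionFreePullback.

Section Hypersurface.
Variables (k : fieldType) (R : realType) (v : absvalue k R).
Variables (c : flavour) (n : nat) (X : hypersurface v c n).
Local Notation O := (germ v c n).
Local Notation OX := (hs_ring X).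
Local Notation pr := (@hs_proj k R v c n X).

(* A finite modification X' -> X is given by the ring of functions of X',
   semi-local when X' is a multi-germ. Surjectivity and birationality are
   encoded by embedding this ring in the total ring of fractions of O_X, i.e.
   by fm_inj, fm_puredim (X' has no component, embedded or not, over a nowhere
   dense subset of X) and fm_birational. The singular locus is cut out by the
   partial derivatives of the equation, hence contains the multiple components;
   fm_iso says that O_X -> O_X' becomes bijective on inverting any of them. *)
Record fin_modification := FinModification {
  fm_ring :> comNzRingType;
  fm_map : {rmorphism OX -> fm_ring};
  fm_inj : injective fm_map;
  fm_finite : exists s : seq fm_ring, forall q, exists a : nat -> OX,
    q = \sum_(i < size s) fm_map (a i) * s`_i;
  fm_puredim : forall s, GRing.lreg s -> GRing.lreg (fm_map s);
  fm_birational : forall q, exists s r, GRing.lreg s /\ fm_map s * q = fm_map r;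
  fm_iso : forall (i : 'I_n) q, exists N r,
    fm_map (pr (germ_deriv i (hs_eqn X))) ^+ N * q = fm_map r }.

Fact id_finite : exists s : seq OX, forall q, exists a : nat -> OX,
  q = \sum_(i < size s) idfun (a i) * s`_i.
Proof. by exists [:: 1] => q; exists (fun=> q); rewrite big_ord1 mulr1. Qed.

Fact id_birational (q : OX) :
  exists s r, GRing.lreg s /\ idfun s * q = idfun r.
Proof. by exists 1, q; split; [exact: lreg1 | rewrite mul1r]. Qed.

Fact id_iso (i : 'I_n) (q : OX) : exists N r,
  idfun (pr (germ_deriv i (hs_eqn X))) ^+ N * q = idfun r.
Proof. by exists 0%N, q; rewrite expr0 mul1r. Qed.

Definition id_modification : fin_modification :=
  @FinModification OX idfun (@inj_id OX) id_finite (fun _ => id) id_birational id_iso.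

(* X1 -> X factorizes as X1 -> X2 -> X. *)
Definition factors_through (X1 X2 : fin_modification) : Prop :=
  exists g : {rmorphism X2 -> X1}, forall r, g (fm_map X2 r) = fm_map X1 r.

Definition isomorphic_over (X1 X2 : fin_modification) : Prop :=
  exists g : {rmorphism X2 -> X1},
    bijective g /\ forall r, g (fm_map X2 r) = fm_map X1 r.

Definition nilpotent (A : comNzRingType) (a : A) : Prop := exists m, a ^+ m = 0.

(* The quotient of A by its nilradical is integrally closed in its total ring
   of fractions: if a / b is integral over it then b divides a in it. *)
Definition normal_reduction (A : comNzRingType) : Prop :=
  forall a b : A, (forall x, nilpotent (b * x) -> nilpotent x) ->
  (exists2 p : {poly A}, p \is monic &
     nilpotent (\sum_(i < size p) p`_i * a ^+ i * b ^+ ((size p).-1 - i))) ->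
  exists x, nilpotent (a - b * x).

(* If X is the union of the p_i X_i, these are the coproducts of the p_i X~_i
   with X~_i the normalization of X_i: the multiplicities are those of X by
   birationality. For reduced X this is the usual normalization. Otherwise the
   multiple structure on the X~_i is not unique; one has to be fixed, since
   O_X then has in general no largest finite extension in its total ring of
   fractions. *)
Definition is_normalization (Xt : fin_modification) : Prop :=
  normal_reduction Xt.

Definition max_saturating (Xt : fin_modification) (E : lmodType OX)
    (X' : fin_modification) : Prop :=
  [/\ factors_through Xt X', saturated (fm_map X') E &
      forall X'' : fin_modification, factors_through Xt X'' ->
        saturated (fm_map X'') E -> factors_through X' X''].

Definition rel_adjoint_ideal (X' : fin_modification) (g : O) : Prop :=
  forall q : X', exists r : OX, fm_map X' (pr g) * q = fm_map X' r.

Variable d : nat.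
Implicit Type M : 'M[O]_d.

Definition det_representation M : Prop :=
  [/\ (1 < d)%N, forall i j, germ_at0 (M i j) = 0 &
      exists u u' : O, u * u' = 1 /\ \det M = u * hs_eqn X].

Definition det_rep_saturated (X' : fin_modification) M : Prop :=
  forall i j, rel_adjoint_ideal X' ((\adj M) i j).

Definition column_span M : {pred 'cV[OX]_d} :=
  fun x => `[< exists w : 'cV[OX]_d, x = map_mx pr (\adj M) *m w >].

Fact column_span_closed M : submod_closed (column_span M).
Proof.
split; first by apply/asboolP; exists 0; rewrite mulmx0.
move=> a _ _ /asboolP[w ->] /asboolP[z ->]; apply/asboolP.
by exists (a *: w + z); rewrite mulmxDr scalemxAr.
Qed.

HB.instance Definition _ M :=
  GRing.isSubmodClosed.Build OX 'cV[OX]_d (column_span M) (column_span_closed M).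

Record kernel_module M :=
  KernelModule { kernel_vect :> 'cV[OX]_d; _ : kernel_vect \in column_span M }.

HB.instance Definition _ M := [isSub for @kernel_vect M].
HB.instance Definition _ M := [Choice of kernel_module M by <:].
HB.instance Definition _ M := [SubChoice_isSubLmodule of kernel_module M by <:].

End Hypersurface.

(* Main.v *)
Require Import Defs.
From HB Require Import structures.
From mathcomp Require Import all_boot all_order all_algebra.
From mathcomp Require Import boolp reals.
From mathcomp Require Import freeg mpoly.
From mathcomp Require Import ring lra zify.

Set Implicit Arguments.
Unset Strict Implicit.
Unset Printing Implicit Defensive.

Import Order.TTheory GRing.Theory Num.Theory.
Local Open Scope ring_scope.

(** The ring of a finite modification [X'] consists of fractions over [O_X], and the
    torsion-free pullback of [E] is the submodule [O_X' E] of the module of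
    fractions of [E]: hence [E] is [X'/X]-saturated iff every [q = r / s] of
    [O_X'] maps [E] to itself, i.e. [r E] is contained in [s E]. So the largest
    modification saturating [E] has ring [{q | q E <= E}]; this is a finite
    [O_X]-module because [O_X] is Noetherian. For the kernel module, saturation
    means that multiplication by [q] preserves the image of [adj M] over [O_X];
    since [M adj M = f] up to a unit and [O] is a domain, this image is the kernel
    of [M], and preserving it amounts to [q adj M] having its entries in [O_X].
    This condition is invariant under transposition.

    [O] is Noetherian by division with remainder (Grauert-Hironaka): for the
    degree-lexicographic order, an ideal has finitely many elements [f_i] whose
    initial monomials generate all initial monomials (Dickson). Division by the
    [f_i] amounts to solving a strictly triangular linear system, whose solution
    exists formally; the system is a contraction for a norm giving [x_j] a weight
    adapted to the order, so that the solution converges if the data do. *)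

(** * Torsion-free pullback *)

Lemma fgliftB (A : comNzRingType) (E : lmodType A) (x y : {freeg E / A}) :
  fglift id (x - y) = fglift id x - fglift id y.
Proof. exact: (lift_is_additive (@id E)). Qed.

(** [fglift id] evaluates a formal combination of elements of [E] in [E]. *)
Lemma fgliftZ (A : comNzRingType) (E : lmodType A) a (x : {freeg E / A}) :
  fglift id (a *: x) = a *: fglift id x.
Proof.
pose F : {additive {freeg E / A} -> E} := HB.pack (fglift (@id E))
  (GRing.isZmodMorphism.Build _ _ (fglift (@id E)) (@fgliftB A E)).
rewrite -{2}(freeg_sumE x) [a *: x]/(fgscale a x) /fgscale.
have -> : fglift id = F by [].
rewrite !raddf_sum; apply: eq_bigr => e _.
by rewrite [LHS]liftU -scalerA [F _]liftU.
Qed.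

(* [q], seen as the fraction [r / s], maps [E] to itself. *)
Definition multiplier (A B : comNzRingType) (nu : A -> B) (E : lmodType A) (q : B) :=
  exists s r, [/\ GRing.lreg s, nu s * q = nu r &
    forall e : E, exists e', s *: e' = r *: e].

Section TorsionFreePullbackTheory.
Variables (A B : comNzRingType) (nu : {rmorphism A -> B}).
Hypothesis nu_inj : injective nu.
Hypothesis nu_lreg : forall s, GRing.lreg s -> GRing.lreg (nu s).
Hypothesis nu_birational :
  forall q, exists s r, GRing.lreg s /\ nu s * q = nu r.
Variable E : lmodType A.

(* A tensor which vanishes in [E (x) B] also vanishes in the module of fractions
   of [E]; instead of building the latter, clear the denominators of all the
   coefficients of the tensor at once. *)
Lemma tensor_relation_clear x : @tensor_relation A B nu E x ->
  exists s (y : {freeg E / A}), [/\ GRing.lreg s,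
    forall e, nu (coeff e y) = nu s * coeff e x & fglift id y = 0].
Proof.
elim=> [e1 e2|a e||b {}x y _ [s1 [x1 [s1r x1x x10]]] _ [s2 [y2 [s2r y2y y20]]]].
- exists 1, (<< e1 + e2 >> - << e1 >> - << e2 >>); split; first exact: lreg1.
    by move=> e; rewrite rmorph1 mul1r !coeffB !coeffU !mul1r !rmorphB !rmorph_nat.
  by rewrite !fgliftB !liftU !scale1r addrAC addrK subrr.
- exists 1, (<< a *: e >> - << a *g e >>); split; first exact: lreg1.
    move=> e'; rewrite rmorph1 mul1r !coeffB !coeffU !mul1r rmorphB rmorphM.
    by rewrite !rmorph_nat.
  by rewrite !fgliftB !liftU scale1r subrr.
- exists 1, 0; split; first exact: lreg1.
    by move=> e; rewrite !coeff0 mulr0 rmorph0.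
  by rewrite -(subrr 0) fgliftB subrr.
(* With [b = r / s0], the product [s0 * s1 * s2] clears all the denominators of [b *: x + y]. The
   sum is written as a difference in order to apply [fgliftB]. *)
- have [s0 [r [s0r bE]]] := nu_birational b.
  exists (s0 * s1 * s2), ((r * s2) *: x1 - (- (s0 * s1)) *: y2); split.
  + by do 2?apply: lregM.
  + move=> e; rewrite coeffB coeffD !coeffZ rmorphB !rmorphM rmorphN rmorphM.
    by rewrite x1x y2y -bE; ring.
  + by rewrite fgliftB !fgliftZ x10 y20 !scaler0 subrr.
Qed.

Local Notation tensor b e := (modproj (@tensor_relations A B nu E) << b *g e >>).

Lemma tensorE b e : tensor b e = b *: tensor 1 e.
Proof.
rewrite -linearZ /=; congr (modproj _ _); apply/eqP/freeg_eqP => z.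
by rewrite coeffZ !coeffU mul1r.
Qed.

Lemma tensor_scale a e : tensor 1 (a *: e) = nu a *: tensor 1 e.
Proof.
rewrite -tensorE; apply/eqP; rewrite modproj_eq; apply/asboolP.
exact: TensorScale.
Qed.

Lemma tensorD e1 e2 : tensor 1 (e1 + e2) = tensor 1 e1 + tensor 1 e2.
Proof.
apply/eqP; rewrite -raddfD modproj_eq opprD addrA; apply/asboolP.
exact: TensorAdd.
Qed.

Lemma tensorB e1 e2 : tensor 1 (e1 - e2) = tensor 1 e1 - tensor 1 e2.
Proof. by rewrite -[- e2]scaleN1r tensorD tensor_scale rmorphN1 scaleN1r. Qed.

(** Torsion over [B] is witnessed by a regular [b] of [B]; its numerator is a regular witness in
    [A]. *)
Lemma lreg_numerator b : GRing.lreg b ->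
  exists s r, [/\ GRing.lreg s, nu s * b = nu r & GRing.lreg r].
Proof.
move=> br; have [s [r [sr bE]]] := nu_birational b; exists s, r; split=> // x y.
move=> /(congr1 nu); rewrite !rmorphM -bE -!mulrA.
by move=> /(nu_lreg sr) /br /nu_inj.
Qed.

Hypothesis E_tf : torsion_free E.

Lemma lreg_scaler a (e : E) : GRing.lreg a -> a *: e = 0 -> e = 0.
Proof. by move=> ar ae; apply: E_tf; apply/asboolP; exists a. Qed.

(** If [b = r / s] kills the tensor of [e], then the tensor of [r *: e] is a relation. Clearing
    denominators in it gives [t *: (r *: e) = 0] with [t] and [r] regular. *)
Lemma tensor_torsion e : tensor 1 e \in @torsion B (base_change nu E) -> e = 0.
Proof.
move=> /asboolP[b [/lreg_numerator[s [r [sr sb rr]]] be]].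
have /eqP : tensor 1 (r *: e) = 0.
  by rewrite tensor_scale -sb -scalerA be scaler0.
rewrite -(raddf0 (modproj (@tensor_relations A B nu E))) modproj_eq subr0.
move=> /asboolP /tensor_relation_clear[t [y [tr yE y0]]].
have y1 : y = << t *g (r *: e) >>.
  apply/eqP/freeg_eqP => z; apply: nu_inj.
  by rewrite yE !coeffU mul1r rmorphM rmorph_nat.
move: y0; rewrite y1 liftU => /(lreg_scaler tr); exact: lreg_scaler.
Qed.

Lemma saturatedP : saturated nu E <-> forall q, multiplier nu E q.
Proof.
have unitB e e' : pullback_unit nu e = pullback_unit nu e' ->
    tensor 1 (e - e') \in @torsion B (base_change nu E).
    by move/eqP; rewrite modproj_eq tensorB.
split=> [[g _ gK] q|mulE].
  have [s [r [sr sq]]] := nu_birational q; exists s, r; split=> // e.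
  pose x := modproj (@torsion B (base_change nu E)) (tensor q e).
  (* By surjectivity, the tensor of [q] and [e] agrees modulo torsion with that of [g x] and 1, so
     [g x] plays the role of [q e]. *)
  have /eqP := gK x; rewrite modproj_eq => /asboolP[b [br bx]].
  exists (g x); apply/eqP; rewrite -subr_eq0; apply/eqP; apply: tensor_torsion.
  apply/asboolP; exists b; split=> //.
  rewrite tensorB !tensor_scale -sq -scalerA.
  by rewrite -(tensorE q) -scalerBr scalerA mulrC -scalerA bx scaler0.
have unit_inj : injective (pullback_unit nu (E := E)).
  by move=> e e' /unitB/tensor_torsion /eqP; rewrite subr_eq0 => /eqP.
have unit_surj (y : pullback_mod_torsion nu E) : exists e, pullback_unit nu e == y.
  rewrite -(modproj_repr y) -(modproj_repr (repr _)).
  (* A class of the pullback is a finite sum of tensors of some [b] with some [e], each of which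
     comes from the element [b e] of [E]. *)
  set x := repr _; rewrite -(freeg_sumE x).
  elim/big_ind: _ => [|z1 z2 [e1 /eqP e1P] [e2 /eqP e2P]|e _].
  - exists 0; by rewrite /pullback_unit -(subrr (0 : E)) tensorB subrr !raddf0.
  - exists (e1 + e2); rewrite /pullback_unit tensorD !raddfD /=.
    by rewrite -/(pullback_unit _ _) e1P -/(pullback_unit _ _) e2P.
  - have [s [r [sr bE /(_ e)[e' e'E]]]] := mulE (coeff e x).
    exists e'; rewrite modproj_eq; apply/asboolP; exists (nu s).
    split; first exact: nu_lreg.
    rewrite scalerBr -tensor_scale e'E tensor_scale -bE -scalerA -tensorE.
    exact: subrr.
exists (fun y => xchoose (unit_surj y)) => [e|y].
  by apply/unit_inj/eqP; apply: (xchooseP (unit_surj _)).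
by apply/eqP; apply: (xchooseP (unit_surj y)).
Qed.

End TorsionFreePullbackTheory.

(** * Monomial orders *)

Section Monomials.
Variable n : nat.
Implicit Types (m a b : 'X_{1..n}).

(** Dickson's lemma by induction on the coordinates that are compared. The list [s0], good for the
    coordinates in [t], also serves the monomials whose new exponent is at least [N], the maximum of
    that exponent on [s0]; below [N] there are finitely many slices of constant exponent. *)
Lemma dickson_coords (t : seq 'I_n) (P : 'X_{1..n} -> Prop) :
  exists s : seq 'X_{1..n}, (forall a, a \in s -> P a) /\
    forall m, P m -> exists2 a, a \in s & forall i, i \in t -> (a i <= m i)%N.
Proof.
elim: t P => [|i t IH] P.
  case: (pselect (exists m, P m)) => [[a Pa]|noP].
    exists [:: a]; split=> [_ /[1!inE] /eqP -> //|m _].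
    by exists a; rewrite ?inE.
  by exists [::]; split=> // m Pm; case: noP; exists m.
have [s0 [s0P s0c]] := IH P; pose N := (\max_(a <- s0) a i)%N.
have [s1 [s1P s1c]] : exists s : seq 'X_{1..n}, (forall a, a \in s -> P a) /\
    forall m, P m -> (m i < N)%N ->
    exists2 a, a \in s & forall j, j \in i :: t -> (a j <= m j)%N.
  elim: N => [|N [s [sP sc]]]; first by exists [::].
  have [s' [s'P s'c]] := IH (fun m => P m /\ m i = N).
  exists (s ++ s'); split=> [a|m Pm].
    by rewrite mem_cat => /orP[/sP|/s'P[]].
  rewrite ltnS leq_eqVlt => /orP[/eqP miN|/(sc _ Pm)[a as_ aP]]; last first.
    by exists a; rewrite // mem_cat as_.
  have [a as' aP] := s'c _ (conj Pm miN).
  exists a; first by rewrite mem_cat as' orbT.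
  move=> j /[1!inE] /orP[/eqP ->|/aP //].
  by have [_ ->] := s'P _ as'; rewrite miN.
exists (s0 ++ s1); split=> [a|m Pm].
  by rewrite mem_cat => /orP[/s0P|/s1P].
case: (ltnP (m i) N) => [/(s1c _ Pm)[a as1 aP]|Nm].
  by exists a; rewrite // mem_cat as1 orbT.
have [a as0 aP] := s0c _ Pm; exists a; first by rewrite mem_cat as0.
move=> j /[1!inE] /orP[/eqP ->|/aP //].
by apply: leq_trans Nm; rewrite /N; apply: leq_bigmax_seq.
Qed.

Lemma dickson (P : 'X_{1..n} -> Prop) :
  exists s : seq 'X_{1..n}, (forall a, a \in s -> P a) /\
    forall m, P m -> exists2 a, a \in s & (a <= m)%MM.
Proof.
have [s [sP sc]] := dickson_coords (enum 'I_n) P; exists s; split=> // m /sc[a as_ am].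
by exists a => //; apply/mnm_lepP => i; rewrite am ?mem_enum.
Qed.

Definition positional D m := (\sum_(k < n) m k * D ^ (n - k.+1))%N.

(** The trailing digits never outweigh one unit of the digit before them; hence the first differing
    digit decides in [positional_lt]. *)
Lemma positional_tail D m j : (j <= n)%N -> (forall k, m k < D)%N ->
  (\sum_(k < n | n - j <= k) m k * D ^ (n - k.+1) < D ^ j)%N.
Proof.
move=> + mD; elim: j => [_|j IH jn].
  by rewrite big1 ?expn0 // => k; rewrite subn0 leqNgt ltn_ord.
have lt_n : (n - j.+1 < n)%N by lia.
rewrite (bigD1 (Ordinal lt_n)) //=.
rewrite (eq_bigl (fun k : 'I_n => (n - j <= k)%N)); last first.
  by move=> k; rewrite -val_eqE /=; lia.
rewrite (_ : n - (n - j.+1).+1 = j)%N; last by lia.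
have := leq_mul (mD (Ordinal lt_n)) (leqnn (D ^ j)); have := IH (ltnW jn).
rewrite expnS mulSn; set u := (\sum_(_ < _ | _) _)%N; lia.
Qed.

Lemma positional_lt D a b : mdeg a = mdeg b -> (mdeg a < D)%N ->
  (a < b)%O -> (positional D a < positional D b)%N.
Proof.
move=> ab aD /(ltmcP ab)[i eq_i lt_i].
have aiD k : (a k < D)%N.
  by apply: leq_ltn_trans aD; rewrite mdegE (bigD1 k) //= leq_addr.
rewrite /positional (bigID (fun k : 'I_n => (k < i)%N)) /=.
rewrite [X in (_ < X)%N](bigID (fun k : 'I_n => (k < i)%N)) /=.
rewrite (eq_bigr (fun k : 'I_n => b k * D ^ (n - k.+1))%N); last first.
  by move=> k ki; rewrite eq_i.
rewrite ltn_add2l (bigD1 i) ?ltnn //= [X in (_ < X)%N](bigD1 i) ?ltnn //=.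
rewrite (eq_bigl (fun k : 'I_n => (n - (n - i.+1) <= k)%N)); last first.
  by move=> k; rewrite -val_eqE /= subKn //; lia.
have := positional_tail (leq_subr i.+1 n) aiD.
have := leq_mul lt_i (leqnn (D ^ (n - i.+1))); rewrite mulSn.
set u := (\sum_(_ < _ | _) _)%N; set w := (\sum_(_ < _ | _) _)%N; lia.
Qed.

(* The weight is a large multiple of the degree plus the number whose digits, in a
   large base, are the exponents. *)
Lemma weight_exists (s : seq 'X_{1..n}) : exists (L : 'X_{1..n} -> nat) (c : nat),
  [/\ forall a b, L (a + b)%MM = (L a + L b)%N,
      forall b, (L b <= c * mdeg b)%N &
      forall a b, a \in s -> (a < b)%O -> (L a < L b)%N].
Proof.
pose D := (\max_(a <- s) mdeg a).+1; pose W := positional D.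
pose w := (\max_(a <- s) W a).+1.
have WD a b : W (a + b)%MM = (W a + W b)%N.
  by rewrite /W /positional -big_split; apply: eq_bigr => k _; rewrite mnmDE mulnDl.
have Wle b : (W b <= D ^ n * mdeg b)%N.
  rewrite mdegE big_distrr /=; apply: leq_sum => k _.
  by rewrite mulnC leq_mul2r leq_pexp2l ?leq_subr ?orbT.
exists (fun m => w * mdeg m + W m)%N, (w + D ^ n)%N; split=> [a b|b|a b as_ ab].
- by rewrite mdegD WD; lia.
- by rewrite mulnDl leq_add2l.
(* Only [a] is bounded, since [b] will run over the infinitely many monomials of a series. In equal
   degree the digits decide; otherwise one unit of degree counts for [w], which exceeds [W a]. *)
- have aD : (mdeg a < D)%N by rewrite ltnS; apply: leq_bigmax_seq.
  have aw : (W a < w)%N by rewrite ltnS; apply: leq_bigmax_seq.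
  have /lemc_mdeg := ltW ab; rewrite leq_eqVlt => /orP[/eqP eq_ab|lt_ab].
    by rewrite eq_ab ltn_add2l; apply: positional_lt.
  have := leq_mul (leqnn w) lt_ab; nia.
Qed.

End Monomials.

(** * Division of power series *)

Section BoundedSums.
Variable n : nat.
Implicit Types (m a b : 'X_{1..n}).

(** Replacing a term by a sum over an indicator allows reindexing by exchange of summations. *)
Lemma sum_bm_delta (V : nmodType) N m (F : 'X_{1..n} -> V) :
  \sum_(b : 'X_{1..n < N} | m == b) F b = if (mdeg m < N)%N then F m else 0.
Proof.
case: ifPn => [mN|/negP mN].
  by rewrite (big_pred1 (BMultinom mN)) // => b; rewrite bmeqP eq_sym.
by rewrite big_pred0 // => b; apply/negP => /eqP mb; apply: mN; rewrite mb bmdeg.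
Qed.

Lemma sum_bm_widen (V : nmodType) M N (F : 'X_{1..n} -> V) : (M <= N)%N ->
  (forall m, (M <= mdeg m)%N -> F m = 0) ->
  \sum_(m : 'X_{1..n < N}) F m = \sum_(m : 'X_{1..n < M}) F m.
Proof.
move=> MN F0.
transitivity (\sum_(m : 'X_{1..n < N}) \sum_(b : 'X_{1..n < M} | bmnm m == b) F b).
  by apply: eq_bigr => m _; rewrite sum_bm_delta; case: ltnP => // /F0.
rewrite (exchange_big_dep predT) //=; apply: eq_bigr => b _.
under eq_bigl => m do rewrite eq_sym.
rewrite (eq_bigr (fun m : 'X_{1..n < N} => F m)) => [|m /eqP -> //].
by rewrite sum_bm_delta (leq_trans (bmdeg b)).
Qed.

(** After the exchange of sums, each [b] is counted at most once, because [phi] is injective on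
    [P]. *)
Lemma sum_bm_inj (R : realType) M N (P : pred 'X_{1..n})
    (phi : 'X_{1..n} -> 'X_{1..n}) (F : 'X_{1..n} -> R) :
  {in P &, injective phi} -> (forall m, 0 <= F m) ->
  (forall m, P m -> (mdeg m < M)%N -> (mdeg (phi m) < N)%N) ->
  \sum_(m : 'X_{1..n < M} | P m) F (phi m) <= \sum_(m : 'X_{1..n < N}) F m.
Proof.
move=> phiI F0 phiN.
rewrite (eq_bigr (fun m : 'X_{1..n < M} =>
    \sum_(b : 'X_{1..n < N} | phi m == b) F b)); last first.
  by move=> m Pm; rewrite sum_bm_delta phiN ?bmdeg.
rewrite (exchange_big_dep predT) //=; apply: ler_sum => b _.
rewrite sumr_const -[leRHS]mulr1n; apply: ler_wpMn2l => //.
apply/card_le1_eqP => x y /andP[Px /eqP xb] /andP[Py /eqP yb].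
by apply/eqP; rewrite bmeqP; apply/eqP/phiI => //; rewrite xb yb.
Qed.

End BoundedSums.

(** * Initial monomials of power series *)

Section Lead.
Variables (n : nat) (K : comNzRingType).
Implicit Types (f g : fps n K) (m a b : 'X_{1..n}).

Lemma fcoefM N f g m : (mdeg m < N)%N ->
  fcoef (f * g) m =
  \sum_(a : 'X_{1..n < N} | (a <= m)%MM) fcoef f a * fcoef g (m - a)%MM.
Proof.
move=> mN; rewrite -[LHS](mcoeff_ftruncM f g mN) /ftrunc mulr_suml raddf_sum /=.
rewrite [RHS]big_mkcond; apply: eq_bigr => a _; rewrite mulr_sumr raddf_sum /=.
rewrite (eq_bigr (fun b : 'X_{1..n < N} =>
    if (a + b)%MM == m then fcoef f a * fcoef g b else 0)); last first.
  move=> b _; rewrite -scalerAl -scalerAr scalerA -mpolyXD mcoeffZ mcoeffX.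
  by case: eqP => _; rewrite ?mulr1 ?mulr0.
case: ifPn => [am|not_am]; last first.
  by rewrite big1 // => b _; case: eqP => // eq_m; rewrite -eq_m lem_addr in not_am.
rewrite -big_mkcond (eq_bigl (fun b : 'X_{1..n < N} => (m - a)%MM == b)) => [|b].
  rewrite (sum_bm_delta N (m - a)%MM (fun b => fcoef f a * fcoef g b)).
  by rewrite (leq_ltn_trans (mdegB _ _) mN).
by rewrite -{1}(submK am) addmC eqm_add2r eq_sym.
Qed.

Lemma fcoef_sum I (r : seq I) (P : pred I) (F : I -> fps n K) m :
  fcoef (\sum_(i <- r | P i) F i) m = \sum_(i <- r | P i) fcoef (F i) m.
Proof. by elim/big_rec2: _ => // i y1 y2 _ <-. Qed.

(** The initial monomial is the smallest one, as a power series need not have a largest one. *)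
Definition lead f m :=
  fcoef f m != 0 /\ forall a, (a < m)%O -> fcoef f a = 0.

Lemma lead_exists f : f != 0 -> exists m, lead f m.
Proof.
move=> f0; have [m fm] : exists m, fcoef f m != 0.
  apply: contrapT => no; case/eqP: f0; apply: fpsP => m.
  by apply/eqP/negPn/negP => fm; apply: no; exists m.
elim/(well_founded_ind (@ltom_wf n)): m fm => m IH fm.
case: (pselect (exists2 a, (a < m)%O & fcoef f a != 0)) => [[a am fa]|no].
  exact: IH am fa.
exists m; split=> // a am; apply/eqP/negPn/negP => fa.
by apply: no; exists a.
Qed.

(** A split of [a + b] into [c] and [a + b - c] other than the expected one has [c] below [a] or
    [a + b - c] below [b], so one of the two factors vanishes. *)
Lemma leadM f g a b : lead f a -> lead g b ->
  fcoef (f * g) (a + b)%MM = fcoef f a * fcoef g b.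
Proof.
move=> [_ fa] [_ gb]; rewrite (fcoefM f g (ltnSn _)).
have aN : (mdeg a < (mdeg (a + b)%MM).+1)%N by rewrite mdegD ltnS leq_addr.
rewrite (bigD1 (BMultinom aN)) /= ?lem_addr // [X in (X - a)%MM]addmC addmK.
rewrite big1 ?addr0 //.
move=> c /andP[cab]; rewrite -val_eqE /= => neq_ca.
case: (ltgtP (bmnm c) a) neq_ca => // [/fa -> _|ac _]; first by rewrite mul0r.
rewrite (gb (a + b - c)%MM) ?mulr0 // -(ltmc_add2l _ _ c) submK //.
by rewrite [X in (_ < X)%O]addmC ltmc_add2l.
Qed.

End Lead.

Section TriangularSystem.
Variables (n : nat) (K : nmodType).

Lemma triangular_fixpoint (Phi : ('X_{1..n} -> K) -> 'X_{1..n} -> K) :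
  (forall G G' m, (forall p, (p < m)%O -> G p = G' p) -> Phi G m = Phi G' m) ->
  exists G, forall m, G m = Phi G m.
Proof.
move=> Phi_lt.
(* Well-founded recursion on the monomial order. The value 0 off [p < m] is a dummy, as [Phi G m]
   depends only on [G] below [m]. *)
pose step m (rec : forall p, (p < m)%O -> K) :=
  Phi (fun p => if Bool.bool_dec (p < m)%O true is left h then rec p h else 0) m.
exists (Fix (@ltom_wf n) (fun=> K) step) => m.
rewrite Fix_eq => [|{}m rec rec' eq_rec]; apply: Phi_lt => p pm.
  by case: Bool.bool_dec.
by case: Bool.bool_dec.
Qed.

End TriangularSystem.

(** * Formal division with remainder by several series *)

Section Division.
Variables (n : nat) (K : comNzRingType) (s : nat).
Variables (f : 'I_s -> fps n K) (alpha : 'I_s -> 'X_{1..n}).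
Hypothesis f_lead : forall i, fcoef (f i) (alpha i) = 1.
Hypothesis f_lt : forall i m, (m < alpha i)%O -> fcoef (f i) m = 0.
Implicit Types (m p a b : 'X_{1..n}) (G : 'X_{1..n} -> K).

Definition divisor p : option 'I_s := [pick i | (alpha i <= p)%MM].

(** Column [p] lists the coefficients of the multiple of [f i] by the monomial [p - alpha i], where
    [i] is the chosen divisor of [p]. Its initial monomial is [p], whence the triangular shape. *)
Definition div_matrix p m : K :=
  if divisor p is Some i then
    if (p - alpha i <= m)%MM then fcoef (f i) (m - (p - alpha i))%MM else 0
  else 0.

(** A single [G] encodes the whole division: [G p] is a coefficient of the quotient attached to the
    divisor of [p], or of the remainder if [p] has no divisor. *)
Definition div_quo G i : fps n K :=
  FPS (fun a => if divisor (a + alpha i)%MM == Some i then G (a + alpha i)%MM else 0).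

Definition div_rem G : fps n K := FPS (fun m => if divisor m is None then G m else 0).

Lemma divisorP p i : divisor p = Some i -> (alpha i <= p)%MM.
Proof. by rewrite /divisor; case: pickP => // j ? [<-]. Qed.

Lemma div_matrix_diag p : div_matrix p p = (divisor p)%:R.
Proof.
rewrite /div_matrix; case dp: divisor => [i|] //.
have ap := divisorP dp; rewrite lem_subr.
by rewrite submBA // addmC addmK f_lead.
Qed.

Lemma div_matrix_triangular p m : ~~ (p <= m)%O -> div_matrix p m = 0.
Proof.
rewrite -ltNge /div_matrix => mp; case dp: divisor => [i|] //; case: ifP => // le_m.
rewrite f_lt // -(ltmc_add2l _ _ (p - alpha i)%MM) submK //.
by rewrite addmC submK ?divisorP.
Qed.

Lemma div_quoM G N i m : (mdeg m < N)%N -> fcoef (div_quo G i * f i) m =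
  \sum_(p : 'X_{1..n < N} | divisor p == Some i) G p * div_matrix p m.
Proof.
move=> mN; rewrite (fcoefM _ _ mN).
rewrite (eq_bigr (fun a : 'X_{1..n < N} =>
    \sum_(p : 'X_{1..n < N} | (a + alpha i)%MM == p)
      if divisor p == Some i then G p * div_matrix p m else 0)); last first.
  move=> a am /=.
  rewrite (sum_bm_delta N _ (fun p => if divisor p == Some i
     then G p * div_matrix p m else 0)) /div_matrix.
  case: eqP => [->|_]; last by rewrite mul0r if_same.
  rewrite addmK am.
  (* Truncation loses nothing: if [a + alpha i] has degree at least [N], then [m - a] has smaller
     degree than [alpha i], so [f i] vanishes there. *)
  case: ltnP => // N_le; rewrite f_lt ?mulr0 // lt_mdeg_ltmc //.
  rewrite -(ltn_add2r (mdeg a)) -mdegD submK // (leq_trans mN) //.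
  by rewrite addnC -mdegD.
rewrite (exchange_big_dep predT) //= [RHS]big_mkcond; apply: eq_bigr => p _.
case: eqP => [dp|_]; last by rewrite big1.
have ap := divisorP dp; have pE := submK ap.
rewrite (eq_bigl (fun a : 'X_{1..n < N} =>
    (p - alpha i <= m)%MM && ((p - alpha i)%MM == a))); last first.
  move=> a; rewrite -[X in (_ == X)%MM]pE eqm_add2r eq_sym andbC [RHS]andbC.
  by case: eqP => [->|].
case: (boolP (p - alpha i <= m)%MM) => /= pm; last first.
  by rewrite big_pred0_eq /div_matrix dp (negPf pm) mulr0.
by rewrite (sum_bm_delta N _ (fun=> _)) (leq_ltn_trans (mdegB _ _) (bmdeg p)).
Qed.

Lemma div_quo_sum G N m : (mdeg m < N)%N ->
  \sum_i fcoef (div_quo G i * f i) m =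
  \sum_(p : 'X_{1..n < N}) G p * div_matrix p m.
Proof.
move=> mN; rewrite (eq_bigr _ (fun i _ => div_quoM G i mN)).
rewrite (exchange_big_dep predT) //=; apply: eq_bigr => p _.
rewrite /div_matrix; case dp: divisor => [i|]; last by rewrite mulr0 big1.
by rewrite (big_pred1 i) // => j; rewrite eq_sym.
Qed.

(** The division identity at [m], solved for [G m], which enters with coefficient 1 either through
    the initial term of some [f i] or through the remainder. As [N] is free, the equations for all
    [m] of degree below [N] share one index set. *)
Definition div_fixpoint g G := forall N m, (mdeg m < N)%N ->
  G m = fcoef g m - \sum_(p : 'X_{1..n < N} | bmnm p != m) G p * div_matrix p m.

Lemma div_fixpoint_exists g : exists G, div_fixpoint g G.
Proof.
have [G G_fix] := @triangular_fixpoint n K (fun G m => fcoef g m -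
    \sum_(p : 'X_{1..n < (mdeg m).+1} | (bmnm p < m)%O) G p * div_matrix p m)
    ltac:(by move=> G G' m eqG; congr (_ - _); apply: eq_bigr => p /eqG ->).
exists G => N m mN; rewrite {1}G_fix; congr (_ - _).
(* Only [p < m] contribute, by triangularity, and they have degree at most [mdeg m]; so the sum is
   the same for every [N]. *)
pose F p := if (p < m)%O then G p * div_matrix p m else 0.
rewrite [LHS]big_mkcond -(sum_bm_widen (F := F) mN) => [|p mp].
  rewrite [RHS]big_mkcond; apply: eq_bigr => p _; rewrite /F.
  by case: (ltgtP (bmnm p) m) => // mp; rewrite div_matrix_triangular ?mulr0 -?ltNge.
by rewrite /F; case: ifP => // /ltW/lemc_mdeg; rewrite leqNgt mp.
Qed.

Lemma div_fixpointP g G : div_fixpoint g G ->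
  g = \sum_i div_quo G i * f i + div_rem G.
Proof.
move=> G_fix; apply: fpsP => m; have mN := ltnSn (mdeg m).
rewrite [RHS]/(_ + _) /= fcoef_sum (div_quo_sum G mN).
rewrite (bigD1 (BMultinom mN)) //= div_matrix_diag.
have -> : fcoef g m = G m + \sum_(p : 'X_{1..n < (mdeg m).+1} | bmnm p != m)
    G p * div_matrix p m by rewrite (G_fix _ _ mN) subrK.
rewrite (eq_bigl (fun p : 'X_{1..n < (mdeg m).+1} => bmnm p != m)) => [|p].
  rewrite [RHS]addrAC; congr (_ + _).
  by case: divisor => [i|]; rewrite ?mulr1 ?addr0 ?mulr0 ?add0r.
by rewrite bmeqP.
Qed.

Lemma div_remP G m : fcoef (div_rem G) m != 0 -> forall i, ~~ (alpha i <= m)%MM.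
Proof.
rewrite /= /divisor; case: pickP => [|no _ i]; first by rewrite eqxx.
by rewrite no.
Qed.

End Division.

(** * Weighted norm estimates for the division, when the tail of each [f i] weighs at most half of
    its initial monomial *)

Section DivisionBound.
Variables (k : fieldType) (R : realType) (v : absvalue k R) (n s : nat).
Variables (f : 'I_s -> fps n k) (alpha : 'I_s -> 'X_{1..n}).

Variable wt : 'X_{1..n} -> R.
Hypothesis wt_gt0 : forall m, 0 < wt m.
Hypothesis wtM : forall a b, wt (a + b)%MM = wt a * wt b.
Hypothesis f_small : forall i N,
  \sum_(b : 'X_{1..n < N} | bmnm b != alpha i) v (fcoef (f i) b) * wt b
    <= 2^-1 * wt (alpha i).

Let wt_ge0 m : 0 <= wt m. Proof. exact: ltW. Qed.

(** The off-diagonal part of a column is a shifted tail of some [f i]; as [wt] is multiplicative,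
    the shift multiplies both sides of [f_small] by the same weight. *)
Lemma div_matrix_col (p : 'X_{1..n}) N :
  \sum_(m : 'X_{1..n < N} | p != m) v (div_matrix f alpha p m) * wt m
    <= 2^-1 * wt p.
Proof.
rewrite /div_matrix; case dp: divisor => [i|]; last first.
  by rewrite big1 ?mulr_ge0 ?invr_ge0 ?ler0n // => m _; rewrite absv0 mul0r.
have ap := divisorP dp; set c := (p - alpha i)%MM.
have pE : p = (c + alpha i)%MM by rewrite submK.
pose H b := if b == alpha i then 0 else v (fcoef (f i) b) * wt b.
have H0 b : 0 <= H b by rewrite /H; case: ifP => // _; rewrite mulr_ge0 ?absv_ge0.
rewrite pE wtM mulrCA.
apply: (@le_trans _ _ (wt c * \sum_(m : 'X_{1..n < N} | (c <= m)%MM) H (m - c)%MM)).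
  rewrite mulr_sumr big_mkcond [leRHS]big_mkcond /=; apply: ler_sum => m _.
  case: (boolP (c <= m)%MM) => cm; last by rewrite absv0 mul0r if_same.
  rewrite /H [in (_ != _)%MM]addmC -[X in _ != X](submK cm) eqm_add2r eq_sym.
  case: eqP => _ /=; first by rewrite mulr0.
  by rewrite -[in wt m](submK cm) wtM mulrA mulrC.
rewrite ler_wpM2l //; apply: le_trans (f_small i N).
apply: (@le_trans _ _ (\sum_(b : 'X_{1..n < N}) H b)); last first.
  by rewrite [leRHS]big_mkcond; apply: ler_sum => b _; rewrite /H; case: eqP.
apply: (sum_bm_inj (P := fun m => (c <= m)%MM) (phi := fun m => (m - c)%MM)) => //.
  move=> x y cx cy /(congr1 (fun z => (z + c)%MM)).
  by rewrite !submK.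
move=> m _ mN.
exact: leq_ltn_trans (mdegB _ _) mN.
Qed.

Definition weighted_norm N (G : 'X_{1..n} -> k) :=
  \sum_(m : 'X_{1..n < N}) v (G m) * wt m.

Lemma div_fixpoint_bound g G N : div_fixpoint f alpha g G ->
  weighted_norm N G <= 2 * weighted_norm N (fcoef g).
Proof.
move=> G_fix.
(* The off-diagonal part contracts by one half. The norms are truncated, hence finite, so that this
   half can be absorbed on the left. *)
suff: weighted_norm N G <= weighted_norm N (fcoef g) + 2^-1 * weighted_norm N G.
  by move: (weighted_norm _ _) (weighted_norm _ _) => x y; lra.
apply: (@le_trans _ _ (weighted_norm N (fcoef g) + \sum_(m : 'X_{1..n < N})
    \sum_(p : 'X_{1..n < N} | bmnm p != m)
      v (G p) * (v (div_matrix f alpha p m) * wt m))).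
  rewrite -big_split; apply: ler_sum => m _.
  rewrite {1}(G_fix N m (bmdeg m)) /=.
  rewrite (eq_bigr _ (fun p _ => mulrA _ _ _)) -mulr_suml -mulrDl ler_wpM2r //.
  apply: le_trans (absv_triangle _ _ _) _; rewrite absvN lerD2l.
  apply: le_trans (absv_sum _ _ _ _) _; apply: ler_sum => p _.
  by rewrite absvM.
rewrite lerD2l mulr_sumr (exchange_big_dep xpredT) //=; apply: ler_sum => p _.
rewrite -mulr_sumr mulrCA ler_wpM2l ?absv_ge0 //.
exact: div_matrix_col.
Qed.

Lemma div_quo_bound G i N :
  weighted_norm N (fcoef (div_quo alpha G i)) * wt (alpha i) <=
  weighted_norm (N + mdeg (alpha i)) G.
Proof.
rewrite /weighted_norm mulr_suml.
apply: (@le_trans _ _ (\sum_(m : 'X_{1..n < N})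
    v (G (m + alpha i)%MM) * wt (m + alpha i)%MM)).
  apply: ler_sum => m _ /=; rewrite wtM -mulrA ler_wpM2r ?mulr_ge0 //.
  by case: ifP; rewrite ?absv0 ?absv_ge0.
apply: (sum_bm_inj (P := xpredT) (phi := fun m => (m + alpha i)%MM)
  (F := fun m => v (G m) * wt m)).
- by move=> x y _ _; apply: addIm.
- by move=> m; rewrite mulr_ge0 ?absv_ge0.
- by move=> m _ mN; rewrite mdegD ltn_add2r.
Qed.

End DivisionBound.

(** * Convergence of the quotients *)

Section ConvergentDivision.
Variables (k : fieldType) (R : realType) (v : absvalue k R) (n : nat).
Implicit Types (f g : fps n k).

Lemma convergent_scale c f :
  convergent v f -> convergent v (FPS (fun m => fcoef f m * c)).
Proof.
move=> [r [r0 [C fC]]]; exists r; split=> //; exists (C * v c) => N.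
apply: le_trans (ler_wpM2r (absv_ge0 v c) (fC N)); rewrite /fps_norm mulr_suml.
by apply: ler_sum => m _ /=; rewrite absvM mulrAC.
Qed.

Lemma convergent_common (l : seq (fps n k)) : (forall f, f \in l -> convergent v f) ->
  exists r C : R, [/\ 0 < r, r <= 1, 0 <= C &
    forall f N, f \in l -> fps_norm v r N f <= C].
Proof.
elim: l => [|g l IH] cv; first by exists 1, 0.
have [|r [C [r0 r1 C0 hC]]] := IH.
  by move=> f fl; apply: cv; rewrite inE fl orbT.
have [s [s0 [D hD]]] : convergent v g by apply: cv; rewrite inE eqxx.
have m0 : 0 < Num.min r s by rewrite lt_min r0.
exists (Num.min r s), (Num.max C D); split; rewrite ?ge_min ?r1 ?le_max ?C0 //.
move=> f N; rewrite inE le_max => /orP[/eqP ->|fl]; apply/orP; [right|left].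
  by apply: le_trans (hD N); apply: fps_norm_le; rewrite ?ge_min ?lexx ?orbT // ltW.
apply: le_trans (hC f N fl).
by apply: fps_norm_le; rewrite ?ge_min ?lexx ?orbT // ltW.
Qed.

(** In the weight [r ^+ mdeg m * eta ^+ L m], every monomial of [f j] beyond [alpha j] gains at
    least one factor [eta], so a small [eta] makes the tails satisfy the hypothesis of the norm
    estimates. *)
Lemma convergent_div_quo s (f : 'I_s -> fps n k) (alpha : 'I_s -> 'X_{1..n}) g G :
    (forall i, fcoef (f i) (alpha i) = 1) ->
    (forall i m, (m < alpha i)%O -> fcoef (f i) m = 0) ->
    (forall i, convergent v (f i)) -> convergent v g ->
    div_fixpoint f alpha g G ->
  forall i, convergent v (div_quo alpha G i).
Proof.
move=> f_lead f_lt f_cv g_cv G_fix i.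
have [|r [C [r0 r1 C0 hC]]] := @convergent_common (g :: [seq f j | j <- enum 'I_s]).
  by move=> h; rewrite inE => /orP[/eqP ->|/mapP[j _ ->]].
have fC j N : fps_norm v r N (f j) <= C.
  by apply: hC; rewrite inE map_f ?orbT // mem_enum.
have gC N : fps_norm v r N g <= C by apply: hC; rewrite inE eqxx.
have [L [c [LD Lc L_lt]]] := weight_exists [seq alpha j | j <- enum 'I_s].
(* Chosen so that [C * eta] is at most half of [r ^+ A], hence of every [r ^+ mdeg (alpha j)], as
   [r <= 1]. Using [C + 1] avoids a zero denominator. *)
pose A := (\max_j mdeg (alpha j))%N; pose eta := r ^+ A / (2 * (C + 1)).
have C1 : 0 < C + 1 by rewrite ltr_wpDl.
have eta0 : 0 < eta by rewrite divr_gt0 ?exprn_gt0 // mulr_gt0.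
have eta1 : eta <= 1.
  rewrite ler_pdivrMr ?mulr_gt0 // mul1r.
  have : r ^+ A <= 1 by rewrite exprn_ile1 // ltW.
  by move: C0 (r ^+ A) => ? ? ?; lra.
pose wt (m : 'X_{1..n}) := r ^+ mdeg m * eta ^+ L m.
have wt0 m : 0 < wt m by rewrite mulr_gt0 ?exprn_gt0.
have wtM a b : wt (a + b)%MM = wt a * wt b.
  by rewrite /wt mdegD LD !exprD mulrACA.
have small j N : \sum_(b : 'X_{1..n < N} | bmnm b != alpha j)
    v (fcoef (f j) b) * wt b <= 2^-1 * wt (alpha j).
  apply: (@le_trans _ _ (fps_norm v r N (f j) * eta ^+ (L (alpha j)).+1)).
    rewrite /fps_norm mulr_suml big_mkcond; apply: ler_sum => b _.
    have b0 : 0 <= v (fcoef (f j) b) * r ^+ mdeg b.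
      by rewrite mulr_ge0 ?absv_ge0 ?exprn_ge0 // ltW.
    case: (ltgtP (bmnm b) (alpha j)) => [/f_lt ->|lt_b|_].
    - by rewrite absv0 !mul0r.
    - rewrite /wt mulrA ler_wpM2l // ler_wiXn2l ?(ltW eta0) //.
      by apply: L_lt => //; rewrite map_f ?mem_enum.
    - by rewrite mulr_ge0 ?exprn_ge0 // ltW.
  rewrite exprS mulrA [leRHS]mulrA ler_wpM2r ?exprn_ge0 ?(ltW eta0) //.
  apply: (@le_trans _ _ (C * eta)); first by rewrite ler_wpM2r ?(ltW eta0).
  have rA : r ^+ A <= r ^+ mdeg (alpha j).
    by rewrite ler_wiXn2l ?(ltW r0) // /A; apply: leq_bigmax.
  apply: (@le_trans _ _ (2^-1 * r ^+ A)); last by rewrite ler_wpM2l // invr_ge0.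
  have -> : C * eta = 2^-1 * r ^+ A * (C / (C + 1)).
    by rewrite /eta; field; rewrite gt_eqF.
  rewrite ler_piMr ?mulr_ge0 ?exprn_ge0 ?invr_ge0 ?(ltW r0) //.
  by rewrite ler_pdivrMr // mul1r lerDl.
have bound_g N : \sum_(m : 'X_{1..n < N}) v (fcoef g m) * wt m <= C.
  apply: le_trans (gC N); apply: ler_sum => m _; rewrite ler_wpM2l ?absv_ge0 //.
  by rewrite ler_piMr ?exprn_ge0 ?(ltW r0) // exprn_ile1 // ltW.
(* Since [L m <= c * mdeg m] and [eta <= 1], the powers of this radius are bounded by [wt]. *)
exists (r * eta ^+ c); split; first by rewrite mulr_gt0 // exprn_gt0.
exists (2 * C / wt (alpha i)) => N; rewrite ler_pdivlMr //.
have := ler_wpM2l (ler0n R 2) (bound_g (N + mdeg (alpha i))%N).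
apply: le_trans.
apply: le_trans (div_fixpoint_bound wt0 wtM small _ G_fix).
apply: le_trans (div_quo_bound v alpha wt0 wtM G i N).
rewrite ler_wpM2r ?(ltW (wt0 _)) //; apply: ler_sum => m _.
rewrite ler_wpM2l ?absv_ge0 // /wt exprMn -exprM ler_wpM2l ?exprn_ge0 ?(ltW r0) //.
by rewrite ler_wiXn2l ?(ltW eta0).
Qed.

End ConvergentDivision.

(** Ideals are given by closure under [a * x + y], which includes the empty predicate; a non-empty
    one contains 0 as a difference. *)
Definition noetherian (A : comNzRingType) := forall I : A -> Prop,
  (forall a x y, I x -> I y -> I (a * x + y)) ->
  exists s (t : 'I_s -> A), (forall i, I (t i)) /\
    forall x, I x -> exists c : 'I_s -> A, x = \sum_i c i * t i.

Lemma admissibleP (k : fieldType) (R : realType) (v : absvalue k R) c n (f : fps n k) :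
  reflect (c = Convergent -> convergent v f) (f \in admissible v c (n := n)).
Proof.
rewrite unfold_in; case: c; first by left.
by apply: (iffP (asboolP _)) => [|cv]; [|exact: cv].
Qed.

(** * The ring of germs is a Noetherian domain *)

Section Germs.
Variables (k : fieldType) (R : realType) (v : absvalue k R) (c : flavour) (n : nat).
Local Notation O := (germ v c n).

Lemma germ_lead (f : O) : f != 0 -> exists m, lead f m.
Proof.
by move=> f0; apply: lead_exists; apply: contraNneq f0 => f0; apply/eqP/val_inj.
Qed.

Lemma germ_mulf_eq0 (f g : O) : f * g = 0 -> f = 0 \/ g = 0.
Proof.
move=> fg0; case: (eqVneq f 0) => [|f0]; first by left.
case: (eqVneq g 0) => [|g0]; first by right.
have [a fa] := germ_lead f0; have [b gb] := germ_lead g0.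
have /esym/eqP := leadM fa gb.
rewrite (congr1 (fun h : O => fcoef h (a + b)%MM) fg0) mulf_eq0.
by rewrite (negPf fa.1) (negPf gb.1).
Qed.

Lemma germ_lreg (f : O) : f != 0 -> GRing.lreg f.
Proof.
move=> f0 x y /eqP; rewrite -subr_eq0 -mulrBr => /eqP /germ_mulf_eq0[f_eq0|/eqP].
  by rewrite f_eq0 eqxx in f0.
by rewrite subr_eq0 => /eqP.
Qed.

Lemma germ_noetherian : noetherian O.
Proof.
move=> I I_lin.
have I_sub x y : I x -> I y -> I (y - x).
  by move=> Ix Iy; rewrite -mulN1r addrC; apply: I_lin.
pose P m := exists f, I f /\ lead (germ_fps f) m.
have [sq [sqP sqc]] := dickson P.
pose alpha (i : 'I_(size sq)) := nth 0%MM sq i.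
have /choice[f fP] : forall i, exists f, I f /\ lead (germ_fps f) (alpha i).
  by move=> i; apply/sqP/mem_nth.
exists (size sq), f; split=> [i|g Ig]; first by case: (fP i).
pose lc i := fcoef (f i) (alpha i).
have lc0 i : lc i != 0 by case: (fP i) => _ [].
(* The division needs initial coefficients equal to 1; the factor [(lc i)^-1] is then moved into the
   quotient [q i]. *)
pose F i := FPS (fun m => fcoef (f i) m * (lc i)^-1).
have F_lead i : fcoef (F i) (alpha i) = 1 by exact: (divff (lc0 i)).
have F_lt i m : (m < alpha i)%O -> fcoef (F i) m = 0.
  by case: (fP i) => _ [_ f_lt] /f_lt /= ->; rewrite mul0r.
have [G G_fix] := div_fixpoint_exists F_lt g.
pose q i := FPS (fun m => fcoef (div_quo alpha G i) m * (lc i)^-1).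
have q_adm i : q i \in @admissible k R v c n.
  apply/admissibleP => c_cv; apply: convergent_scale.
  have cv (h : O) : convergent v h by exact: (admissibleP _ _ _ (germP h)).
  apply: convergent_div_quo F_lead F_lt _ (cv g) G_fix _ => j.
  exact: convergent_scale.
have gE : germ_fps g = \sum_i germ_fps (Germ (q_adm i) * f i) + div_rem alpha G.
  rewrite [LHS](div_fixpointP F_lead F_lt G_fix); congr (_ + _).
  apply: eq_bigr => i _; apply: fpsP => m /=; apply: eq_bigr => h _.
  by rewrite mulrA mulrAC.
exists (fun i => Germ (q_adm i)); apply/eqP; rewrite -subr_eq0; apply/eqP.
set r := g - _; have Ir : I r.
  apply: (I_sub _ _ _ Ig); elim/big_ind: _ => [|x y Ix Iy|i _].
  - by rewrite -(subrr g); apply: I_sub.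
  - by rewrite -[x]mul1r; apply: I_lin.
  - rewrite -[_ * _]addr0; apply: I_lin; first by case: (fP i).
    by rewrite -(subrr g); apply: I_sub.
(* The remainder is itself a germ of [I]. If non-zero, its initial monomial would be divisible by
   some [alpha i], which division excludes. *)
have rE : germ_fps r = div_rem alpha G.
  transitivity (germ_fps g - \sum_i germ_fps (Germ (q_adm i) * f i)).
    by rewrite -[germ_fps r]/(val r) raddfB raddf_sum.
  by rewrite gE addrC addKr.
apply/eqP; apply: contraT => r0.
have [m rm] := germ_lead r0.
have [a as_ am] := sqc m (ex_intro _ r (conj Ir rm)).
have ia : (index a sq < size sq)%N by rewrite index_mem.
have := rm.1; rewrite rE => /div_remP /(_ (Ordinal ia)).
by rewrite /alpha nth_index // am.
Qed.

End Germs.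

(** * Finite modifications *)

Lemma noetherian_surj (A B : comNzRingType) (p : {rmorphism A -> B}) :
  (forall b, exists a, p a = b) -> noetherian A -> noetherian B.
Proof.
move=> p_surj noethA I I_lin.
have [|s [t [It tP]]] := noethA (fun a => I (p a)).
  by move=> a x y; rewrite rmorphD rmorphM; apply: I_lin.
exists s, (p \o t); split=> // b; have [a <-] := p_surj b => /tP[c ->].
by exists (p \o c); rewrite rmorph_sum; apply: eq_bigr => i _; rewrite rmorphM.
Qed.

Section Fractions.
Variables (A B : comNzRingType) (nu : {rmorphism A -> B}).
Hypothesis nu_inj : injective nu.
Hypothesis nu_lreg : forall s, GRing.lreg s -> GRing.lreg (nu s).

Lemma common_denominator (t : seq B) :
  (forall q, exists s r, GRing.lreg s /\ nu s * q = nu r) ->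
  exists s, GRing.lreg s /\ forall q, q \in t -> exists r, nu s * q = nu r.
Proof.
move=> birat; elim: t => [|q t [s [sr st]]].
  by exists 1; split=> //; exact: lreg1.
have [s' [r' [s'r qE]]] := birat q.
exists (s * s'); split=> [|q']; first exact: lregM.
rewrite inE => /orP[/eqP ->|/st[r q'E]].
  by exists (s * r'); rewrite !rmorphM -mulrA qE.
by exists (s' * r); rewrite mulrC !rmorphM -q'E; ring.
Qed.

(* Multiplication by a common denominator of [B] identifies [S] with an ideal. *)
Lemma submod_fin_gen (S : B -> Prop) s : noetherian A -> GRing.lreg s ->
  (forall q, S q -> exists r, nu s * q = nu r) ->
  (forall a x y, S x -> S y -> S (nu a * x + y)) ->
  exists m (t : 'I_m -> B), (forall i, S (t i)) /\
    forall q, S q -> exists c : 'I_m -> A, q = \sum_i nu (c i) * t i.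
Proof.
move=> noethA sr den S_lin.
have [|m [t [It tP]]] := noethA (fun a => exists2 q, S q & nu a = nu s * q).
  move=> a x y [q Sq xq] [q' Sq' yq']; exists (nu a * q + q'); first exact: S_lin.
  by rewrite rmorphD rmorphM xq yq'; ring.
have /choice[u uP] : forall i, exists q, S q /\ nu (t i) = nu s * q.
  by move=> i; have [q Sq tq] := It i; exists q.
exists m, u; split=> [i|q Sq]; first by case: (uP i).
have [r qr] := den q Sq; have [|c rc] := tP r; first by exists q.
exists c; apply: (nu_lreg sr); rewrite qr rc rmorph_sum mulr_sumr.
by apply: eq_bigr => i _; rewrite rmorphM (uP i).2 mulrCA.
Qed.

Variable E : lmodType A.

Lemma multiplier_map a : multiplier nu E (nu a).
Proof.
exists 1, a; split; [exact: lreg1|by rewrite rmorph1 mul1r|move=> e].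
by exists (a *: e); rewrite scale1r.
Qed.

Lemma multiplierB x y :
  multiplier nu E x -> multiplier nu E y -> multiplier nu E (x - y).
Proof.
move=> [s [r [sr xE rE]]] [s' [r' [s'r yE r'E]]].
exists (s * s'), (r * s' - s * r'); split; first exact: lregM.
  by rewrite rmorphB !rmorphM -xE -yE; ring.
move=> e; have [e1 e1E] := rE e; have [e2 e2E] := r'E e; exists (e1 - e2).
rewrite scalerBr scalerBl; congr (_ - _); last by rewrite -!scalerA e2E.
by rewrite [s * s']mulrC -scalerA e1E scalerA [s' * r]mulrC.
Qed.

Lemma multiplierM x y :
  multiplier nu E x -> multiplier nu E y -> multiplier nu E (x * y).
Proof.
move=> [s [r [sr xE rE]]] [s' [r' [s'r yE r'E]]].
exists (s * s'), (r * r'); split; first exact: lregM.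
  by rewrite !rmorphM -xE -yE; ring.
move=> e; have [e1 e1E] := rE e; have [e2 e2E] := r'E e1; exists e2.
by rewrite -scalerA e2E scalerA [s * r']mulrC -(scalerA r') e1E scalerA [r' * r]mulrC.
Qed.

End Fractions.

Section Hypersurface.
Variables (k : fieldType) (R : realType) (v : absvalue k R) (c : flavour) (n : nat).
Variable X : hypersurface v c n.
Local Notation O := (germ v c n).
Local Notation OX := (hs_ring X).
Local Notation pr := (@hs_proj k R v c n X).

Lemma hs_proj_surj (a : OX) : exists g, pr g = a.
Proof. by exists (repr a); apply: reprK. Qed.

Lemma hs_proj_eq0 g : pr g = 0 <-> exists h, g = h * hs_eqn X.
Proof.
rewrite -(rmorph0 pr); split=> [/eqP|gP].
  by rewrite /hs_proj -Quotient.idealrBE subr0 => /asboolP.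
by apply/eqP; rewrite /hs_proj -Quotient.idealrBE subr0; apply/asboolP.
Qed.

Lemma hs_ring_noetherian : noetherian OX.
Proof. exact: noetherian_surj hs_proj_surj (@germ_noetherian k R v c n). Qed.

Lemma fm_saturatedP (X' : fin_modification X) (E : lmodType OX) : torsion_free E ->
  saturated (fm_map X') E <-> forall q, multiplier (fm_map X') E q.
Proof.
by apply: saturatedP; [apply: fm_inj|apply: fm_puredim|apply: fm_birational].
Qed.

(** Each [q] is a fraction over the image of [OX] with regular denominator, so it is determined by
    its multiple [fm_map X' s * q]. *)
Lemma fm_endo_id (X' : fin_modification X) (g : X' -> X') :
  (forall a b, g (a * b) = g a * g b) ->
  (forall r, g (fm_map X' r) = fm_map X' r) -> g =1 id.
Proof.
move=> gM g_map q; have [s [r [sr qE]]] := fm_birational q.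
by apply: (fm_puredim sr); rewrite -{1}g_map -gM qE g_map.
Qed.

Lemma factors_iso (X1 X2 : fin_modification X) :
  factors_through X1 X2 -> factors_through X2 X1 -> isomorphic_over X1 X2.
Proof.
move=> [g gP] [h hP]; exists g; split=> //; exists h.
  by apply: (@fm_endo_id X2 (h \o g)) => [a b|r] /=; rewrite ?rmorphM // gP hP.
by apply: (@fm_endo_id X1 (g \o h)) => [a b|r] /=; rewrite ?rmorphM // hP gP.
Qed.

(** * The modification whose ring consists of the multipliers of [E] in [Xt] *)

Section Multipliers.
Variables (Xt : fin_modification X) (E : lmodType OX).

Definition multipliers : {pred Xt} := fun q => `[< multiplier (fm_map Xt) E q >].

Fact multipliers_subring : subring_closed multipliers.
Proof.
split=> [|x y /asboolP Ex /asboolP Ey|x y /asboolP Ex /asboolP Ey]; apply/asboolP.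
- by rewrite -(rmorph1 (fm_map Xt)); apply: multiplier_map.
- exact: multiplierB.
- exact: multiplierM.
Qed.

HB.instance Definition _ :=
  GRing.isSubringClosed.Build Xt multipliers multipliers_subring.

Record multiplier_ring :=
  MultiplierRing { multiplier_val :> Xt; _ : multiplier_val \in multipliers }.

HB.instance Definition _ := [isSub for multiplier_val].
HB.instance Definition _ := [Choice of multiplier_ring by <:].
HB.instance Definition _ := [SubChoice_isSubComNzRing of multiplier_ring by <:].

Fact multiplier_in_map a : fm_map Xt a \in multipliers.
Proof. by apply/asboolP/multiplier_map. Qed.

Definition multiplier_ring_map (a : OX) : multiplier_ring :=
  MultiplierRing (multiplier_in_map a).

Fact multiplier_ring_map_additive : {morph multiplier_ring_map : x y / x - y}.
Proof. by move=> x y; apply: val_inj; rewrite /= rmorphB. Qed.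

Fact multiplier_ring_map_monoid : GRing.monoid_morphism multiplier_ring_map.
Proof. by split=> [|x y]; apply: val_inj; rewrite /= ?rmorph1 ?rmorphM. Qed.

HB.instance Definition _ :=
  GRing.isZmodMorphism.Build OX multiplier_ring multiplier_ring_map
    multiplier_ring_map_additive.
HB.instance Definition _ :=
  GRing.isMonoidMorphism.Build OX multiplier_ring multiplier_ring_map
    multiplier_ring_map_monoid.

Fact multiplier_ring_inj : injective multiplier_ring_map.
Proof. by move=> x y /(congr1 multiplier_val) /= /fm_inj. Qed.

Fact multiplier_ring_puredim s : GRing.lreg s -> GRing.lreg (multiplier_ring_map s).
Proof.
move=> sr x y /(congr1 multiplier_val) /= xy.
by apply: val_inj; apply: (fm_puredim sr).
Qed.

Fact multiplier_ring_birational (q : multiplier_ring) :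
  exists s r, GRing.lreg s /\ multiplier_ring_map s * q = multiplier_ring_map r.
Proof.
have [s [r [sr qE]]] := fm_birational (q : Xt).
by exists s, r; split=> //; apply: val_inj.
Qed.

Fact multiplier_ring_iso (i : 'I_n) (q : multiplier_ring) : exists N r,
  multiplier_ring_map (pr (germ_deriv i (hs_eqn X))) ^+ N * q = multiplier_ring_map r.
Proof.
have [N [r qE]] := fm_iso i (q : Xt); exists N, r; apply: val_inj.
by rewrite -[LHS]/(val _ * val q) rmorphXn.
Qed.

(** A common denominator of finitely many generators of [Xt] serves for all of [Xt], hence for the
    multipliers, which thus correspond to an ideal of the Noetherian ring [OX]. *)
Fact multiplier_ring_finite :
  exists s : seq multiplier_ring, forall q, exists a : nat -> OX,
  q = \sum_(i < size s) multiplier_ring_map (a i) * s`_i.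
Proof.
have [t tP] := fm_finite Xt.
have [s [sr st]] := common_denominator t (@fm_birational _ _ _ _ _ _ Xt).
have den (q : Xt) : exists r, fm_map Xt s * q = fm_map Xt r.
  have /choice[r rP] : forall i : 'I_(size t),
      exists r, fm_map Xt s * t`_i = fm_map Xt r.
    by move=> i; apply/st/mem_nth.
  have [a ->] := tP q; exists (\sum_(i < size t) a i * r i).
  rewrite rmorph_sum mulr_sumr.
  by apply: eq_bigr => i _; rewrite rmorphM -rP mulrCA.
have [||m [u [Su uP]]] := submod_fin_gen (@fm_puredim _ _ _ _ _ _ Xt)
  (S := fun q => q \in multipliers) hs_ring_noetherian sr.
- by move=> q _; apply: den.
- by move=> a x y xm ym; rewrite rpredD // rpredM // multiplier_in_map.
pose w i := MultiplierRing (Su i).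
exists [seq w i | i <- enum 'I_m] => q; have [a qE] := uP _ (valP q).
have {}qE : q = \sum_i multiplier_ring_map (a i) * w i.
  by apply: val_inj; rewrite raddf_sum.
exists (fun i => oapp a 0 (insub i)); rewrite {1}qE size_map size_enum_ord.
apply: eq_bigr => i _; rewrite valK /=.
by rewrite (nth_map i) ?size_enum_ord // nth_ord_enum.
Qed.

Definition multiplier_modification : fin_modification X :=
  @FinModification k R v c n X multiplier_ring multiplier_ring_map multiplier_ring_inj
    multiplier_ring_finite multiplier_ring_puredim multiplier_ring_birational
    multiplier_ring_iso.

Hypothesis E_tf : torsion_free E.

Lemma multiplier_modification_max : max_saturating Xt E multiplier_modification.
Proof.
split.
- pose g : {rmorphism multiplier_ring -> Xt} := val.
  by exists g.
- apply/fm_saturatedP => // q.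
  have /asboolP[s [r [sr qE rE]]] := valP (q : multiplier_ring).
  by exists s, r; split=> //; apply: val_inj.
move=> X'' [g gP] /(fm_saturatedP _ E_tf) satE.
(* A fraction that represents [q] in [X''] also represents [g q] in [Xt], so [g] lands in the
   multipliers. *)
have gm q : g q \in multipliers.
  apply/asboolP; have [s [r [sr qE rE]]] := satE q.
  by exists s, r; split=> //; rewrite -!gP -qE rmorphM.
pose h q : multiplier_ring := MultiplierRing (gm q).
have hB : {morph h : x y / x - y} by move=> x y; apply: val_inj; rewrite /= rmorphB.
have hM : GRing.monoid_morphism h.
  by split=> [|x y]; apply: val_inj; rewrite /= ?rmorph1 ?rmorphM.
pose hR : {rmorphism X'' -> multiplier_ring} := HB.pack h
  (GRing.isZmodMorphism.Build _ _ h hB) (GRing.isMonoidMorphism.Build _ _ h hM).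
by exists hR => r; apply: val_inj => /=; rewrite gP.
Qed.

End Multipliers.

(** * Saturation of kernel modules *)

Section KernelModule.
Variables (d : nat) (M : 'M[O]_d).
Hypothesis M_rep : det_representation X M.
Local Notation adjX := (map_mx pr (\adj M)).

Lemma kernel_module_torsion_free : torsion_free (kernel_module X M).
Proof.
move=> x /asboolP[a [ar /(congr1 (@kernel_vect _ _ _ _ _ _ _ _)) ax]].
apply: val_inj; apply/matrixP => i j; rewrite [RHS]mxE; apply: ar.
by move/matrixP/(_ i j): ax; rewrite !mxE mulr0.
Qed.

Lemma mul_rep_adj : map_mx pr M *m adjX = 0.
Proof.
case: M_rep => _ _ [u [u' [_ detM]]].
have pr0 : pr (\det M) = 0 by apply/hs_proj_eq0; exists u.
by rewrite -map_mxM mul_mx_adj map_scalar_mx (congr1 _ pr0) raddf0.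
Qed.

Lemma det_rep_lreg : GRing.lreg (\det M).
Proof.
case: M_rep => _ _ [u [u' [uu' ->]]]; apply: lregM; last exact/germ_lreg/hs_eqn_neq0.
by move=> x y /(congr1 (fun z => u' * z)); rewrite !mulrA [u' * u]mulrC uu' !mul1r.
Qed.

(** Lift [x] to [Y] over [O]: then [M *m Y] is divisible by the equation, hence by [\det M].
    Applying [\adj M] and cancelling the regular [\det M] writes [Y] as [\adj M *m Z]. *)
Lemma rep_syzygy (x : 'cV[OX]_d) : map_mx pr M *m x = 0 -> x \in column_span M.
Proof.
have [_ _ [u [u' [uu' detM]]]] := M_rep.
have /choice[y yP] : forall i, exists g, pr g = x i 0 by move=> i; apply: hs_proj_surj.
pose Y := \col_i y i; have YE : map_mx pr Y = x.
  by apply/matrixP => i j; rewrite !mxE yP [j]ord1.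
rewrite -YE -map_mxM => MY0.
have /choice[h hP] : forall i, exists h, (M *m Y) i 0 = h * hs_eqn X.
  by move=> i; apply/hs_proj_eq0; move/matrixP/(_ i 0): MY0; rewrite !mxE.
pose Z := \col_i (h i * u').
have MYZ : M *m Y = \det M *: Z.
  apply/matrixP => i j; rewrite [j]ord1 hP detM !mxE.
  by rewrite [RHS]mulrC -mulrA [u' * _]mulrA [u' * u]mulrC uu' mul1r.
have YZ : Y = \adj M *m Z.
  have : \det M *: Y = \det M *: (\adj M *m Z).
    by rewrite scalemxAr -MYZ mulmxA mul_adj_mx mul_scalar_mx.
  by move/matrixP => eqYZ; apply/matrixP => i j; apply: det_rep_lreg;
     move: (eqYZ i j); rewrite !mxE.
by apply/asboolP; exists (map_mx pr Z); rewrite YZ map_mxM.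
Qed.

(** Applying a multiplier to the columns of the adjugate shows that [q] times each entry lies in
    [OX]. Conversely, these products form a matrix [N] over [OX] standing for [q] times the
    adjugate; it is killed by [M], so its columns lie in the kernel module by [rep_syzygy]. *)
Lemma kernel_saturatedP (X' : fin_modification X) :
  saturated (fm_map X') (kernel_module X M) <-> det_rep_saturated X' M.
Proof.
rewrite fm_saturatedP; last exact: kernel_module_torsion_free.
split=> [satE i j q|adj_sat q].
  have [s [r [sr qE rE]]] := satE q.
  have colM : adjX *m delta_mx j 0 \in column_span M by apply/asboolP; eexists.
  have [e' /(congr1 (@kernel_vect _ _ _ _ _ _ _ _))] := rE (KernelModule colM).
  move=> /matrixP/(_ i 0); rewrite /= -colE !mxE => e'E.
  exists (kernel_vect e' i 0); apply: (fm_puredim sr).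
  by rewrite mulrCA qE -!rmorphM mulrC -e'E.
have [s [r [sr qE]]] := fm_birational q; exists s, r; split=> // -[x xM].
have /choice[N0 N0P] : forall ij : 'I_d * 'I_d, exists a,
    fm_map X' (pr ((\adj M) ij.1 ij.2)) * q = fm_map X' a by move=> ij; apply: adj_sat.
pose N := \matrix_(i, j) N0 (i, j).
have sN : s *: N = r *: adjX.
  apply/matrixP => i j; apply: (fm_inj (f := X')).
  rewrite [(s *: N) i j]mxE [N i j]mxE [(r *: adjX) i j]mxE [adjX i j]mxE.
  by rewrite !rmorphM -(N0P (i, j)) -qE mulrCA mulrC.
(* For [x] equal to the adjugate times [w], the element [q x] is [N *m w]; that [M] kills it is
   checked after multiplying by the regular [s]. *)
have /asboolP[w xE] := xM.
have Nw : N *m w \in column_span M.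
  apply: rep_syzygy; apply/matrixP => i j; apply: sr.
  have : s *: (map_mx pr M *m (N *m w)) = 0.
    rewrite scalemxAr scalemxAl sN -scalemxAl -scalemxAr mulmxA mul_rep_adj.
    by rewrite mul0mx scaler0.
  by move/matrixP/(_ i j); rewrite !mxE mulr0.
exists (KernelModule Nw); apply: val_inj => /=.
by rewrite scalemxAl sN -scalemxAl -xE.
Qed.

End KernelModule.

Lemma det_representation_tr d (M : 'M[O]_d) :
  det_representation X M -> det_representation X M^T.
Proof. by case=> d1 M0 detM; split=> // [i j|]; rewrite ?mxE ?det_tr. Qed.

Lemma det_rep_saturated_tr (X' : fin_modification X) d (M : 'M[O]_d) :
  det_rep_saturated X' M -> det_rep_saturated X' M^T.
Proof. by move=> satM i j; rewrite -trmx_adj mxE. Qed.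

End Hypersurface.

Theorem proposition4p3
    (k : closedFieldType) (R : realType) (v : absvalue k R)
    (k_complete : complete_absvalue v) (k_char0 : [pchar k] =i pred0)
    (c : flavour) (n : nat) (X : hypersurface v c n) :
  [/\
      forall E : lmodType (hs_ring X), torsion_free E ->
        saturated (fm_map (id_modification X)) E,
      forall Xt : fin_modification X, is_normalization Xt ->
      forall E : lmodType (hs_ring X), torsion_free E ->
        exists X' : fin_modification X, max_saturating Xt E X' /\
          (forall X1 : fin_modification X, max_saturating Xt E X1 ->
             isomorphic_over X' X1),
      forall (X' : fin_modification X) (d : nat) (M : 'M[germ v c n]_d),
        det_representation X M ->
        (saturated (fm_map X') (kernel_module X M) <-> det_rep_saturated X' M) &
      forall (X' : fin_modification X) (d : nat) (M : 'M[germ v c n]_d),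
        det_representation X M ->
        (saturated (fm_map X') (kernel_module X M) <->
         saturated (fm_map X') (kernel_module X M^T))].
Proof.
split=> [E E_tf|Xt _ E E_tf|X' d M|X' d M M_rep].
- by apply/fm_saturatedP => // q; apply: (@multiplier_map _ _ idfun).
- exists (multiplier_modification Xt E).
  have [X'_Xt X'_sat X'_max] := multiplier_modification_max Xt E_tf.
  split=> // X1 [X1_Xt X1_sat X1_max].
  (* Two maximal modifications factor through each other. *)
  by apply: factors_iso; [apply: X'_max|apply: X1_max].
- by move=> M_rep; apply: kernel_saturatedP.
- rewrite !kernel_saturatedP //; last exact: det_representation_tr.
  by split=> /det_rep_saturated_tr //; rewrite trmxK.
Qed.
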